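(* Let $p,j,k\in\mathbb C$, $r\in\mathbb Z$, and suppose that $p+j-\frac k2=-r(k+1)$ or $p-j-\frac k2=-r(k+1)$. Then the $s\ell(2|1)$ Verma module with the highest-weight vector $|p,j,k\rangle$ has a singular vector, as follows. (II) If $p+j-\frac k2=-r(k+1)$, the topological representative of the singular vector is $$|E(r,j,k)\rangle^{(2)}_{\rm ch}=\begin{cases}E^2_{r-1/2}\cdots E^2_{-3/2}\cdot F^1_{r+1/2}\cdots F^1_{-1/2}\,|p,j,k\rangle,& r\le-1,\\ E^1_{-r+1/2}\cdots E^1_{-1/2}\cdot F^2_{-r+1/2}F^2_{-r+3/2}\cdots F^2_{1/2}\,|p,j,k\rangle,& r\ge0,\end{cases}$$ which satisfies the topological-II highest-weight conditions with $\theta=r$, and its minimal-level representative, which satisfies the highest-weight conditions with $\theta=0$, is $$|S(r,j,k)\rangle^{(2)}_{\rm ch}=\begin{cases}E^1_{1/2}\cdots E^1_{-r-1/2}\,F^2_{3/2}\cdots F^2_{-r-1/2}\,|E(r,j,k)\rangle^{(2)}_{\rm ch},& r\le-1,\\ E^2_{-1/2}\cdots E^2_{r-3/2}\,F^1_{1/2}\cdots F^1_{r-1/2}\,|E(r,j,k)\rangle^{(2)}_{\rm ch},& r\ge0.\end{cases}$$ (I) If $p-j-\frac k2=-r(k+1)$, the topological representative of the singular vector is $$|E(r,j,k)\rangle^{(1)}_{\rm ch}=\begin{cases}E^2_{r-1/2}\cdots E^2_{-3/2}\cdot F^1_{r-1/2}F^1_{r+1/2}\cdots F^1_{-1/2}\,|p,j,k\rangle,&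 r\le0,\\ E^1_{-r+1/2}\cdots E^1_{-1/2}\cdot F^2_{-r+3/2}\cdots F^2_{1/2}\,|p,j,k\rangle,& r\ge1,\end{cases}$$ which satisfies the topological-I highest-weight conditions with $\theta=r$, and its minimal-level representative, which satisfies the highest-weight conditions with $\theta=0$, is $$|S(r,j,k)\rangle^{(1)}_{\rm ch}=\begin{cases}E^1_{1/2}\cdots E^1_{-r-1/2}\,F^2_{3/2}\cdots F^2_{-r+1/2}\,|E(r,j,k)\rangle^{(1)}_{\rm ch},& r\le0,\\ E^2_{-1/2}\cdots E^2_{r-3/2}\,F^1_{1/2}\cdots F^1_{r-3/2}\,|E(r,j,k)\rangle^{(1)}_{\rm ch},& r\ge1.\end{cases}$$ In all products the mode numbers increase by $1$ from left to right, and a product whose first mode exceeds its last mode by $1$ is empty.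
   Context: Affine $s\ell(2|1)$ at level $k\in\mathbb C$: the complex Lie superalgebra with even generators $E^{12}_n,F^{12}_n,H^+_n,H^-_n$ ($n\in\mathbb Z$) and odd generators $E^1_n,E^2_n,F^1_n,F^2_n$ ($n\in\mathbb Z+\frac12$), with nonvanishing supercommutators $[H^-_m,E^{12}_n]=E^{12}_{m+n}$, $[H^-_m,F^{12}_n]=-F^{12}_{m+n}$, $[E^{12}_m,F^{12}_n]=m\delta_{m+n,0}k+2H^-_{m+n}$, $[H^\pm_m,H^\pm_n]=\mp\frac12m\delta_{m+n,0}k$, $[F^{12}_m,E^2_n]=F^1_{m+n}$, $[E^{12}_m,F^2_n]=-E^1_{m+n}$, $[F^{12}_m,E^1_n]=-F^2_{m+n}$, $[E^{12}_m,F^1_n]=E^2_{m+n}$, $[H^\pm_m,E^1_n]=\frac12E^1_{m+n}$, $[H^\pm_m,F^1_n]=-\frac12F^1_{m+n}$, $[H^\pm_m,E^2_n]=\mp\frac12E^2_{m+n}$, $[H^\pm_m,F^2_n]=\pm\frac12F^2_{m+n}$, $[E^1_m,F^1_n]=-m\delta_{m+n,0}k+H^+_{m+n}-H^-_{m+n}$, $[E^2_m,F^2_n]=m\delta_{m+n,0}k+H^+_{m+n}+H^-_{m+n}$, $[E^1_m,E^2_n]=E^{12}_{m+n}$, $[F^1_m,F^2_n]=F^{12}_{m+n}$. Generalized highest-weight annihilation conditions with parameter $\theta\in\mathbb Z$: annihilation by $E^1_{n}$ ($n\ge-\theta+\frac12$), $E^2_{n}$ ($n\ge\theta-\frac12$),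 $F^1_{n}$ ($n\ge\theta+\frac12$), $F^2_{n}$ ($n\ge-\theta+\frac32$), $E^{12}_{n}$ ($n\ge0$), $F^{12}_{n}$ ($n\ge1$), $H^\pm_{n}$ ($n\ge1$). The vector $|p,j,k\rangle$ satisfies these with $\theta=0$ together with $H^+_0|p,j,k\rangle=p|p,j,k\rangle$, $H^-_0|p,j,k\rangle=j|p,j,k\rangle$; the Verma module is freely generated from it by the remaining generators (the induced module). Topological-II conditions with parameter $\theta$: the generalized annihilation conditions with parameter $\theta$, and in addition annihilation by $F^2_{-\theta+1/2}$ and by $(\theta-\frac12)k+H^-_0+H^+_0$. Topological-I conditions with parameter $\theta$: the generalized annihilation conditions with parameter $\theta$, and in addition annihilation by $F^1_{\theta-1/2}$ and by $(\theta-\frac12)k-H^-_0+H^+_0$. A singular vector is a nonzero vector of the Verma module that satisfies the generalized annihilation conditions for some $\theta\in\mathbb Z$ and generates a proper submodule; different representatives are vectors, satisfying the conditions with different $\theta$, obtained from it by acting with fermionic modes inside that submodule. *)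

(* Defs.v *)
From HB Require Import structures.
From mathcomp Require Import all_boot all_order all_algebra.
From mathcomp Require Export complex.
From mathcomp Require Export reals.

Set Implicit Arguments.
Unset Strict Implicit.
Unset Printing Implicit Defensive.

Import Order.TTheory GRing.Theory Num.Theory.
Local Open Scope ring_scope.

Inductive fam := E12 | F12 | Hp | Hm | E1 | E2 | F1 | F2.

Definition fam_rank (X : fam) : nat :=
  match X with
  | E12 => 0 | F12 => 1 | Hp => 2 | Hm => 3
  | E1 => 4 | E2 => 5 | F1 => 6 | F2 => 7
  end.

Lemma fam_rank_inj : injective fam_rank.
Proof. by case; case. Qed.

HB.instance Definition _ := Equality.copy fam (inj_type fam_rank_inj).

(* Hp and Hm are H^+ and H^-.  For X even, (X, n) is the generator X_n.  For X
   odd, whose modes lie in Z + 1/2, (X, n) is the generator X_{n + 1/2}.       *)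
Definition gen : Type := (fam * int)%type.

Definition fermionic (x : gen) : bool :=
  match x.1 with E1 | E2 | F1 | F2 => true | _ => false end.

Definition mode (x : gen) : rat := x.2%:~R + (if fermionic x then 1 / 2 else 0).

(* run X a b = [:: X_a; X_(a+1); ...; X_b], for X odd and modes a, b in
   Z + 1/2; it is empty when b < a.                                            *)
Definition run (X : fam) (a b : rat) : seq gen :=
  [seq (X, Num.floor a + i%:Z) | i <- iota 0 (Num.truncn (b - a + 1))].

Section Algebra.
Variables (C : fieldType) (k : C).

(* (c, [:: (c1, x1); ...]) stands for c + c1 x1 + ... *)
Definition lincomb : Type := (C * seq (C * gen))%type.

(* The listed supercommutators [x, y]; [s] is the index (in the sense of [gen])
   of a generator of mode [mode x + mode y], and [z] is m delta_{m+n,0} k.     *)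
Definition listed_bracket (x y : gen) : option lincomb :=
  let s : int := x.2 + y.2 + (fermionic x && fermionic y)%:Z in
  let z : C := if mode x + mode y == 0 then ratr (mode x) * k else 0 in
  let h : C := 1 / 2 in
  match x.1, y.1 with
  | Hm, E12 => Some (0, [:: (1, (E12, s))])
  | Hm, F12 => Some (0, [:: (- 1, (F12, s))])
  | E12, F12 => Some (z, [:: (2, (Hm, s))])
  | Hp, Hp => Some (- (h * z), [::])
  | Hm, Hm => Some (h * z, [::])
  | F12, E2 => Some (0, [:: (1, (F1, s))])
  | E12, F2 => Some (0, [:: (- 1, (E1, s))])
  | F12, E1 => Some (0, [:: (- 1, (F2, s))])
  | E12, F1 => Some (0, [:: (1, (E2, s))])
  | Hp, E1 | Hm, E1 => Some (0, [:: (h, (E1, s))])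
  | Hp, F1 | Hm, F1 => Some (0, [:: (- h, (F1, s))])
  | Hp, E2 => Some (0, [:: (- h, (E2, s))])
  | Hm, E2 => Some (0, [:: (h, (E2, s))])
  | Hp, F2 => Some (0, [:: (h, (F2, s))])
  | Hm, F2 => Some (0, [:: (- h, (F2, s))])
  | E1, F1 => Some (- z, [:: (1, (Hp, s)); (- 1, (Hm, s))])
  | E2, F2 => Some (z, [:: (1, (Hp, s)); (1, (Hm, s))])
  | E1, E2 => Some (0, [:: (1, (E12, s))])
  | F1, F2 => Some (0, [:: (1, (F12, s))])
  | _, _ => None
  end.

Definition sgn (x y : gen) : C := (- 1) ^+ (fermionic x && fermionic y).

(* Unlisted pairs are either listed in the other order, where
   [x, y] = - (-1)^(|x||y|) [y, x], or supercommute.                           *)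
Definition bracket (x y : gen) : lincomb :=
  match listed_bracket x y, listed_bracket y x with
  | Some l, _ => l
  | None, Some l =>
      (- sgn x y * l.1, [seq (- sgn x y * cx.1, cx.2) | cx <- l.2])
  | None, None => (0, [::])
  end.

Record sl21_rep (V : lmodType C) := Sl21Rep {
  op : gen -> {linear V -> V};
  op_bracket : forall (x y : gen) (u : V),
    op x (op y u) - sgn x y *: op y (op x u)
    = (bracket x y).1 *: u + \sum_(cx <- (bracket x y).2) cx.1 *: op cx.2 u
}.

End Algebra.

Definition annihilator (theta : int) (x : gen) : bool :=
  let t : rat := theta%:~R in
  match x.1 with
  | E1 => - t + 1 / 2 <= mode x
  | E2 => t - 1 / 2 <= mode x
  | F1 => t + 1 / 2 <= mode x
  | F2 => - t + 3 / 2 <= mode x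
  | E12 => 0 <= mode x
  | F12 | Hp | Hm => 1 <= mode x
  end.

Definition creation (x : gen) : bool :=
  [&& ~~ annihilator 0 x, x != (Hp, 0) & x != (Hm, 0)].

(* Ordered monomials in the creation generators, for the lexicographic order on
   [gen]; an odd generator occurs at most once.                                *)
Definition ordered_step (x y : gen) : bool :=
  (fam_rank x.1 < fam_rank y.1)%N
  || (x.1 == y.1) && (if fermionic x then x.2 < y.2 else x.2 <= y.2).

Definition pbw_monomial (w : seq gen) : bool :=
  all creation w && sorted ordered_step w.

Section Modules.
Variables (C : fieldType) (k : C) (V : lmodType C) (rho : sl21_rep k V).

(* The leftmost generator of the word acts last. *)
Definition act (w : seq gen) (u : V) : V := foldr (fun x => op rho x) u w.

Definition gen_hw (theta : int) (u : V) : Prop :=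
  forall x : gen, annihilator theta x -> op rho x u = 0.

Definition topological2 (theta : int) (u : V) : Prop :=
  [/\ gen_hw theta u,
      forall x : gen, x.1 = F2 -> mode x = - theta%:~R + 1 / 2 -> op rho x u = 0
    & (theta%:~R - 1 / 2) * k *: u + op rho (Hm, 0) u + op rho (Hp, 0) u = 0].

Definition topological1 (theta : int) (u : V) : Prop :=
  [/\ gen_hw theta u,
      forall x : gen, x.1 = F1 -> mode x = theta%:~R - 1 / 2 -> op rho x u = 0
    & (theta%:~R - 1 / 2) * k *: u - op rho (Hm, 0) u + op rho (Hp, 0) u = 0].

(* V is freely generated by the creation generators from the highest-weight
   vector v: the ordered monomials applied to v form a basis of V.             *)
Definition is_verma (p j : C) (v : V) : Prop :=
  [/\ gen_hw 0 v,
      op rho (Hp, 0) v = p *: v,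
      op rho (Hm, 0) v = j *: v,
      forall u : V, exists (ws : seq (seq gen)) (c : seq gen -> C),
        all pbw_monomial ws /\ u = \sum_(w <- ws) c w *: act w v
    & forall (ws : seq (seq gen)) (c : seq gen -> C),
        uniq ws -> all pbw_monomial ws ->
        \sum_(w <- ws) c w *: act w v = 0 ->
        forall w, w \in ws -> c w = 0].

Definition submodule (P : V -> Prop) : Prop :=
  [/\ P 0,
      forall (a : C) (u u' : V), P u -> P u' -> P (a *: u + u')
    & forall (x : gen) (u : V), P u -> P (op rho x u)].

Definition generated (e u : V) : Prop :=
  forall P : V -> Prop, submodule P -> P e -> P u.

Definition singular (e : V) : Prop :=
  [/\ e <> 0,
      exists theta : int, gen_hw theta e
    & exists u : V, ~ generated e u].

Definition representative (e : V) (theta : int) (u : V) : Prop :=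
  [/\ u <> 0,
      gen_hw theta u,
      generated e u
    & exists w : seq gen, all fermionic w /\ u = act w e].

End Modules.

Section ChargedSingularWords.
Variable r : int.
Let q : rat := r%:~R.

Definition E2ch : seq gen :=
  if r <= - 1 then run E2 (q - 1 / 2) (- (3 / 2)) ++ run F1 (q + 1 / 2) (- (1 / 2))
  else run E1 (- q + 1 / 2) (- (1 / 2)) ++ run F2 (- q + 1 / 2) (1 / 2).

Definition S2ch : seq gen :=
  if r <= - 1 then run E1 (1 / 2) (- q - 1 / 2) ++ run F2 (3 / 2) (- q - 1 / 2)
  else run E2 (- (1 / 2)) (q - 3 / 2) ++ run F1 (1 / 2) (q - 1 / 2).

Definition E1ch : seq gen :=
  if r <= 0 then run E2 (q - 1 / 2) (- (3 / 2)) ++ run F1 (q - 1 / 2) (- (1 / 2))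
  else run E1 (- q + 1 / 2) (- (1 / 2)) ++ run F2 (- q + 3 / 2) (1 / 2).

Definition S1ch : seq gen :=
  if r <= 0 then run E1 (1 / 2) (- q - 1 / 2) ++ run F2 (3 / 2) (- q + 1 / 2)
  else run E2 (- (1 / 2)) (q - 3 / 2) ++ run F1 (1 / 2) (q - 3 / 2).

End ChargedSingularWords.

(* Main.v *)
(** Set [b = true] for the direction theta > 0 and [b = false] for theta < 0.  In either direction
    the twisted annihilation conditions are reached from theta = 0 by odd reflections: applying in
    turn the modes [gx], [gy] moves theta one step away from 0, and applying their conjugates
    [dy], [dx] moves it one step back.  These steps need no condition on (p, j, k).  The charged
    condition makes one conjugate mode annihilate the vector reached, and this extra annihilation
    is the topological condition.

    Properness: let E be the topological vector.  Every generator is a creation operator, or one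
    of the conjugate modes occurring in S, or acts on E by a scalar.  So U(g)E is spanned by
    creation words applied to subsets of the S modes applied to E.  Such a subset is too small to
    bring the H^+ charge of E back to that of the vacuum, so the result lies in the span of
    nonempty creation words, which does not contain the vacuum by PBW.

    Nonvanishing of S: filter by degree, with degree 2 for even and degree 1 for odd generators.
    In the associated graded module even generators commute with everything and odd ones only
    contract pairwise.  Of all contractions between S and E a single matching consists of creation
    operators, and S = +- (E12_(-1))^a (F12_0)^c x_(-1) |p,j,k> modulo lower degree. *)
Require Import Defs.
From mathcomp Require Import all_boot all_order all_algebra.
From mathcomp Require Import zify ring lra.
Import Order.TTheory GRing.Theory Num.Theory.
Set Implicit Arguments.
Unset Strict Implicit.
Unset Printing Implicit Defensive.
Local Open Scope ring_scope.
Local Open Scope complex_scope.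

(** * Linear spans of predicates *)

Section Span.
Variables (C : fieldType) (V : lmodType C).
Implicit Types (W : V -> Prop) (u : V).

(** Inductive, so that a statement about a span is proved by splitting off one spanning vector at a
    time, without carrying families of coefficients. *)
Inductive lspan W : V -> Prop :=
| lspan0 : lspan W 0
| lspan_cons c u u' : W u -> lspan W u' -> lspan W (c *: u + u').

Lemma lspan_gen W u : W u -> lspan W u.
Proof. by move=> Wu; rewrite -[u]addr0 -[u]scale1r; apply: lspan_cons Wu (lspan0 _). Qed.

Lemma lspanD W u u' : lspan W u -> lspan W u' -> lspan W (u + u').
Proof.
move=> Wu Wu'; elim: Wu => [|c u1 u2 W1 _ IH]; first by rewrite add0r.
by rewrite -addrA; apply: lspan_cons.
Qed.

Lemma lspanZ W c u : lspan W u -> lspan W (c *: u).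
Proof.
elim=> [|d u1 u2 W1 _ IH]; first by rewrite scaler0; apply: lspan0.
by rewrite scalerDr scalerA; apply: lspan_cons.
Qed.

Lemma lspanN W u : lspan W u -> lspan W (- u).
Proof. by rewrite -scaleN1r; apply: lspanZ. Qed.

Lemma lspanB W u u' : lspan W u -> lspan W u' -> lspan W (u - u').
Proof. by move=> Wu Wu'; apply: lspanD Wu (lspanN Wu'). Qed.

Lemma lspan_sum W (I : eqType) (s : seq I) (F : I -> V) :
  (forall i, i \in s -> lspan W (F i)) -> lspan W (\sum_(i <- s) F i).
Proof.
elim: s => [|i s IH] H; first by rewrite big_nil; apply: lspan0.
rewrite big_cons; apply: lspanD; first by apply: H; rewrite mem_head.
by apply: IH => i' Hi'; apply: H; rewrite in_cons Hi' orbT.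
Qed.

Lemma lspan_lin W W' (f : {linear V -> V}) u :
  (forall u', W u' -> lspan W' (f u')) -> lspan W u -> lspan W' (f u).
Proof.
move=> H; elim=> [|c u1 u2 W1 _ IH]; first by rewrite linear0; apply: lspan0.
by rewrite linearP; apply: lspanD => //; apply: lspanZ; apply: H.
Qed.

Lemma lspan_sub W W' u :
  (forall u', W u' -> lspan W' u') -> lspan W u -> lspan W' u.
Proof.
move=> H; elim=> [|c u1 u2 W1 _ IH]; first exact: lspan0.
by apply: lspanD => //; apply: lspanZ; apply: H.
Qed.

End Span.

(** * Degrees, integral index conditions, and brackets of creation generators *)

Definition degree (x : gen) : nat := if fermionic x then 1 else 2.
Definition wdeg (w : seq gen) : nat := sumn [seq degree x | x <- w].

Lemma wdeg_cons x w : wdeg (x :: w) = (degree x + wdeg w)%N. Proof. by []. Qed.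

Lemma annihilatorE (t : int) (x : gen) : annihilator t x =
  match x.1 with
  | E1 => - t <= x.2
  | E2 => t - 1 <= x.2
  | F1 => t <= x.2
  | F2 => 1 - t <= x.2
  | E12 => 0 <= x.2
  | F12 | Hp | Hm => 1 <= x.2
  end.
Proof.
case: x => [[] n]; rewrite /annihilator /mode /= ?addr0 -?(ler_int rat);
  rewrite ?rmorphB ?rmorphN //=; apply/idP/idP => H; lra.
Qed.

Lemma creationE (x : gen) : creation x =
  match x.1 with
  | E12 | Hp | Hm | E1 | F1 => x.2 < 0
  | F12 | F2 => x.2 < 1
  | E2 => x.2 < - 1
  end.
Proof.
case: x => [[] n]; by rewrite /creation annihilatorE /= ?xpair_eqE /= ?andbT; lia.
Qed.

Lemma mode_sum0 (x y : gen) : fermionic x = fermionic y ->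
  (mode x + mode y == 0) = (x.2 + y.2 + (fermionic x)%:Z == 0).
Proof.
rewrite /mode => <-; rewrite -(eqr_int rat) !rmorphD /=.
case: (fermionic x) => /=; apply/eqP/eqP; lra.
Qed.

Section Bracket.
Variables (C : numFieldType) (k : C).

(** The creation generators span a subalgebra: a pair with a central term never has opposite modes,
    and the index of the bracket stays in the creation range. *)
Lemma listed_bracket_creation (x y : gen) l : creation x -> creation y ->
  listed_bracket k x y = Some l -> l.1 = 0 /\ all (fun cz => creation cz.2) l.2.
Proof.
move=> Hx Hy El.
suff: if listed_bracket k x y is Some l' then
  l'.1 = 0 /\ all (fun cz => creation cz.2) l'.2 else True by rewrite El.
move: Hx Hy {El}; case: x => [f m]; case: y => [g n]; rewrite !creationE.
case: f; case: g; lazy beta iota zeta delta [listed_bracket fst snd all];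
  try exact: (fun _ _ => I).
all: move=> Hx Hy; rewrite ?creationE; split.
all: try reflexivity.
all: try (by rewrite /= ?andbT; lia).
all: by rewrite mode_sum0 //=; case: eqP => [E|_]; [lia | rewrite ?mulr0 ?oppr0].
Qed.

Lemma bracket_creation (x y : gen) : creation x -> creation y ->
  (bracket k x y).1 = 0 /\ all (fun cz => creation cz.2) (bracket k x y).2.
Proof.
move=> Hx Hy; rewrite /bracket.
case E: (listed_bracket k x y) => [l|]; first exact: listed_bracket_creation E.
case E': (listed_bracket k y x) => [l|] //=.
have [-> Hl] := listed_bracket_creation Hy Hx E'.
by rewrite mulr0 all_map; split.
Qed.

(** An odd-odd bracket is even, of degree 2 = 1 + 1, while an even [x] preserves the parity of [y].
    Commuting an even generator therefore loses 2 in total degree, whereas an odd contraction may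
    lose nothing. *)
Lemma bracket_degree (x y : gen) cz : cz \in (bracket k x y).2 ->
  (degree cz.2 <= degree x + degree y)%N /\
  (~~ fermionic x -> (degree cz.2 <= degree y)%N).
Proof.
case: x => [f m]; case: y => [g n].
case: f; case: g; rewrite /bracket /= ?inE //;
 (try case/orP); move/eqP ->; by rewrite /degree.
Qed.

End Bracket.

(** * Straightening of creation words *)

Lemma ordered_step_trans : transitive ordered_step.
Proof.
move=> [f n] [g m] [h l]; rewrite /ordered_step /fermionic.
by case: f; case: g; case: h => //=; lia.
Qed.

Lemma ordered_step_total (x y : gen) :
  [|| ordered_step x y, ordered_step y x | fermionic x && (x == y)].
Proof.
case: x => [f m]; case: y => [g n]; rewrite /ordered_step /fermionic xpair_eqE.
by case: f; case: g => //=; lia.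
Qed.

Section Words.
Variables (C : numFieldType) (k : C) (V : lmodType C) (rho : sl21_rep k V).
Local Notation op := (op rho).
Local Notation act := (act rho).

Definition words (Q : seq gen -> Prop) (u0 u : V) : Prop :=
  exists2 w, Q w & u = act w u0.

Lemma act_cat w1 w2 u : act (w1 ++ w2) u = act w1 (act w2 u).
Proof. by rewrite /Defs.act foldr_cat. Qed.

Lemma act0 w : act w 0 = 0.
Proof. by elim: w => //= x w ->; rewrite linear0. Qed.

Lemma actZ w c u : act w (c *: u) = c *: act w u.
Proof. by elim: w => //= x w ->; rewrite linearZ. Qed.

Lemma actD w u u' : act w (u + u') = act w u + act w u'.
Proof. by elim: w => //= x w ->; rewrite linearD. Qed.

Lemma opC x y u : op x (op y u) = sgn C x y *: op y (op x u)
  + ((bracket k x y).1 *: u + \sum_(cz <- (bracket k x y).2) cz.1 *: op cz.2 u).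
Proof. by rewrite -(op_bracket rho) addrC subrK. Qed.

Lemma op_sq0 x u : fermionic x -> op x (op x u) = 0.
Proof.
move=> fx; have := op_bracket rho x x u.
rewrite /sgn fx /= expr1 scaleN1r opprK.
have -> : bracket k x x = (0, [::]) by move: fx; case: x => [[] n].
rewrite big_nil scale0r addr0 -mulr2n -scaler_nat => /eqP.
by rewrite scaler_eq0 pnatr_eq0 /= => /eqP.
Qed.

(** Equal words are merged, since the independence clause of [is_verma] speaks of duplicate-free
    lists. *)
Lemma lspan_words_uniq Q u0 u : lspan (words Q u0) u ->
  exists ws c, [/\ uniq ws, (forall w, w \in ws -> Q w)
                 & u = \sum_(w <- ws) c w *: act w u0].
Proof.
elim=> [|a u1 u2 [w Qw ->] _ [ws [c [Uws Qws ->]]]].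
  by exists [::], (fun _ => 0); rewrite big_nil.
have [wws|wws] := boolP (w \in ws).
  exists ws, (fun w' => if w' == w then a + c w else c w'); split=> //.
  rewrite (bigD1_seq w) //= [RHS](bigD1_seq w) //= eqxx scalerDl addrA.
  by congr (_ + _); apply: eq_bigr => w' /negPf ->.
exists (w :: ws), (fun w' => if w' == w then a else c w'); split=> /=.
- by rewrite wws.
- by move=> w'; rewrite in_cons => /orP[/eqP ->|/Qws].
- rewrite big_cons eqxx; congr (_ + _); rewrite !big_seq; apply: eq_bigr => w' ww'.
  by case: eqP => // E; rewrite -E ww' in wws.
Qed.

End Words.

(** * PBW independence, the degree filtration and the augmentation subspace *)

Section Verma.
Variables (C : numFieldType) (k : C) (V : lmodType C) (rho : sl21_rep k V).
Variables (p j : C) (v : V) (hV : is_verma rho p j v).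
Local Notation op := (op rho).
Local Notation act := (act rho).
Local Notation words := (words rho).

Lemma pbw_independent (Q : seq gen -> Prop) w0 : pbw_monomial w0 ->
  (forall w, Q w -> pbw_monomial w) -> ~ Q w0 -> ~ lspan (words Q v) (act w0 v).
Proof.
move=> Hw0 HQ nQ /lspan_words_uniq[ws [c [Uws Qws E]]].
have w0ws : w0 \notin ws by apply/negP => /Qws.
case: hV => _ _ _ _ /(_ (w0 :: ws) (fun w => if w == w0 then -1 else c w)).
rewrite /= w0ws Uws Hw0 big_cons eqxx scaleN1r => /(_ isT) H.
have H1 : all pbw_monomial ws by apply/allP => w /Qws /HQ.
have := H H1 _ w0 (mem_head _ _); rewrite eqxx => H2.
have /eqP : -1 = 0 :> C; last by rewrite oppr_eq0 oner_eq0.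
apply: H2; rewrite [in X in - X + _]E; apply/eqP; rewrite addrC subr_eq0; apply/eqP.
rewrite !big_seq; apply: eq_bigr => w Hw.
by case: eqP => // Ew; rewrite -Ew Hw in w0ws.
Qed.

(* The last clause separates the sorted word on the letters of [x :: w], which [y] extends to a
   sorted word, from the shorter words, which the induction on the size handles. *)
Lemma straighten n x w : (size w <= n)%N -> creation x -> pbw_monomial w ->
  lspan (words (fun w' => [/\ pbw_monomial w', w' != [::],
      (wdeg w' <= degree x + wdeg w)%N, (size w' <= (size w).+1)%N
      & (size w' <= size w)%N \/ {subset w' <= x :: w}]) v) (op x (act w v)).
Proof.
elim: n x w => [|n IH] x w sw cx pw.
  case: w sw pw => // _ _; apply: lspan_gen; exists [:: x] => //; split=> //.
  - by rewrite /pbw_monomial /= cx.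
  - by right.
case: w sw pw => [|y w] sw pw.
  apply: lspan_gen; exists [:: x] => //; split=> //.
  - by rewrite /pbw_monomial /= cx.
  - by right.
have [/= /andP[cy cw] sow] := andP pw.
have pw' : pbw_monomial w by rewrite /pbw_monomial cw (path_sorted sow).
have /or3P[oxy|oyx|/andP[fx /eqP exy]] := ordered_step_total x y.
- apply: lspan_gen; exists [:: x, y & w] => //; split=> //.
  + by rewrite /pbw_monomial /= cx cy cw oxy.
  + by right.
- rewrite [act _ _]/= opC; apply: lspanD.
    apply: lspanZ; have := IH x w sw cx pw'.
    apply: lspan_lin => _ [w1 [pw1 nw1 dw1 sw1 H] ->].
    (* A shorter [w1] leaves room for a second use of the induction hypothesis to insert [y]; a [w1]
       on the letters of [x :: w] accepts [y] in front, as [y] precedes all of them. *)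
    case: H => H.
      have := IH y w1 (leq_trans H sw) cy pw1; apply: lspan_sub => _ [w2 [? ? ? ? _] ->].
      apply: lspan_gen; exists w2 => //; split=> //; rewrite ?wdeg_cons; try lia.
    apply: lspan_gen; exists (y :: w1) => //; split=> //.
    + case/andP: pw1 => c1 s1; rewrite /pbw_monomial /= cy c1 /=.
      rewrite path_sortedE; last exact: ordered_step_trans.
      rewrite s1 andbT; apply/allP => z /H; rewrite in_cons => /orP[/eqP -> //|zw].
      move: sow; rewrite path_sortedE; last exact: ordered_step_trans.
      by case/andP => /allP /(_ z zw).
    + by rewrite ?wdeg_cons; lia.
    + right => z; rewrite !in_cons => /orP[-> |/H]; rewrite ?orbT //.
      by rewrite in_cons => /orP[-> |-> ]; rewrite ?orbT.
  have [-> cr] := bracket_creation k cx cy; rewrite scale0r add0r.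
  apply: lspan_sum => cz Hcz; apply: lspanZ.
  have := IH cz.2 w sw (allP cr _ Hcz) pw'; apply: lspan_sub => _ [w2 [? ? ? ? _] ->].
  have [dz _] := bracket_degree Hcz.
  apply: lspan_gen; exists w2 => //; split=> //; rewrite ?wdeg_cons; try lia.
- by rewrite exy /= op_sq0 -?exy //; apply: lspan0.
Qed.

Lemma creation_words_pbw w : all creation w ->
  lspan (words (fun w' => [/\ pbw_monomial w', (wdeg w' <= wdeg w)%N
                           & w != [::] -> w' != [::]]) v) (act w v).
Proof.
elim: w => [_|x w IH /= /andP[cx /IH H]]; first by apply: lspan_gen; exists [::].
move: H; apply: lspan_lin => _ [w1 [p1 d1 _] ->].
have := straighten (leqnn _) cx p1; apply: lspan_sub => _ [w2 [? ? ? _ _] ->].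
by apply: lspan_gen; exists w2 => //; split=> //; rewrite ?wdeg_cons; lia.
Qed.

(** Words need not be ordered here, which makes the effect of creation generators immediate;
    [creation_words_pbw] returns to ordered monomials without raising the degree. *)
Definition filt (m : nat) : V -> Prop :=
  lspan (words (fun w => all creation w && (wdeg w <= m)%N) v).

(** The augmentation ideal of the creation subalgebra, applied to the vacuum. *)
Definition augmentation : V -> Prop :=
  lspan (words (fun w => all creation w && (w != [::])) v).

Lemma pbw_notin_filt w m : pbw_monomial w -> (m < wdeg w)%N -> ~ filt m (act w v).
Proof.
move=> pw Hm H.
apply: (@pbw_independent (fun w' => pbw_monomial w' /\ (wdeg w' <= m)%N) w) => //.
- by move=> w' [].
- by case=> _; rewrite leqNgt Hm.
move: H; apply: lspan_sub => _ [w1 /andP[c1 d1] ->].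
have := creation_words_pbw c1; apply: lspan_sub => _ [w2 [p2 d2 _] ->].
by apply: lspan_gen; exists w2 => //; split=> //; apply: leq_trans d2 d1.
Qed.

Lemma vacuum_notin_augmentation : ~ augmentation v.
Proof.
move=> H; apply: (@pbw_independent
  (fun w' => pbw_monomial w' /\ w' != [::]) [::]) => //.
- by move=> w [].
- by case.
move: H; apply: lspan_sub => _ [w1 /andP[c1 d1] ->].
have := creation_words_pbw c1; apply: lspan_sub => _ [w2 [p2 _ /(_ d1) d2] ->].
by apply: lspan_gen; exists w2.
Qed.

Lemma verma_decomp u : exists c, augmentation (u - c *: v).
Proof.
case: hV => _ _ _ /(_ u) [ws [c [pws ->]]] _; elim: ws pws => [_|w ws IH /= /andP[pw pws]].
  by exists 0; rewrite big_nil scale0r subr0; apply: lspan0.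
have [d Hd] := IH pws; rewrite big_cons.
have [/eqP ->|nw] := boolP (w == [::]).
  exists (c [::] + d); rewrite scalerDl opprD addrACA subrr add0r //.
exists d; rewrite -addrA; apply: lspanD => //; apply: lspanZ; apply: lspan_gen.
by exists w => //; case/andP: pw => -> _.
Qed.

End Verma.

(** * Degree filtration and proper submodules *)

(** Twice the charge under [(Hp, 0)], doubled to stay integral; [hm2] does the same for
    [(Hm, 0)]. *)
Definition hp2 (x : gen) : int :=
  match x.1 with E1 | F2 => 1 | E2 | F1 => -1 | _ => 0 end.

Definition hm2 (x : gen) : int :=
  match x.1 with
  | E12 => 2 | F12 => -2 | E1 | E2 => 1 | F1 | F2 => -1 | _ => 0
  end.

Section Cartan.
Variables (C : numFieldType) (k : C) (V : lmodType C) (rho : sl21_rep k V).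
Local Notation op := (op rho).
Local Notation act := (act rho).

Lemma op_Hp0 x u :
  op (Hp, 0) (op x u) = op x (op (Hp, 0) u) + ((hp2 x)%:~R / 2) *: op x u.
Proof.
rewrite opC; case: x => [[] n]; rewrite /sgn /hp2 expr0 scale1r; congr (_ + _);
  rewrite ?mul0r ?scale0r /bracket;
  lazy beta iota zeta delta [listed_bracket fst snd map];
  rewrite ?big_nil ?big_seq1 ?scale0r ?add0r ?addr0 //=.
- by rewrite /mode /= addr0 rmorph0 mul0r if_same mulr0 oppr0 scale0r.
all: by rewrite ?mulNr ?rmorphN ?mul1r.
Qed.

Lemma op_Hm0 x u :
  op (Hm, 0) (op x u) = op x (op (Hm, 0) u) + ((hm2 x)%:~R / 2) *: op x u.
Proof.
rewrite opC; case: x => [[] n]; rewrite /sgn /hm2 expr0 scale1r; congr (_ + _);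
  rewrite ?mul0r ?scale0r /bracket;
  lazy beta iota zeta delta [listed_bracket fst snd map];
  rewrite ?big_nil ?big_seq1 ?scale0r ?add0r ?addr0 //=.
3: by rewrite /mode /= addr0 rmorph0 mul0r if_same mulr0 scale0r.
all: by rewrite ?mulNr ?rmorphN ?mul1r ?divff ?pnatr_eq0.
Qed.

Lemma act_Hp0 w u q : op (Hp, 0) u = q *: u ->
  op (Hp, 0) (act w u) = (q + (\sum_(x <- w) hp2 x)%:~R / 2) *: act w u.
Proof.
move=> Hu; elim: w => [|x w IH] /=; first by rewrite big_nil mul0r addr0.
by rewrite op_Hp0 IH linearZ -scalerDl big_cons rmorphD /= mulrDl addrA addrAC.
Qed.

Lemma act_Hm0 w u q : op (Hm, 0) u = q *: u ->
  op (Hm, 0) (act w u) = (q + (\sum_(x <- w) hm2 x)%:~R / 2) *: act w u.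
Proof.
move=> Hu; elim: w => [|x w IH] /=; first by rewrite big_nil mul0r addr0.
by rewrite op_Hm0 IH linearZ -scalerDl big_cons rmorphD /= mulrDl addrA addrAC.
Qed.

End Cartan.

(* The amount by which a generator can raise [filt]: zero for the even non-creation ones. *)
Definition edegree (x : gen) : nat :=
  if ~~ creation x && ~~ fermionic x then 0 else degree x.

Lemma edegree_le x : (edegree x <= degree x)%N.
Proof. by rewrite /edegree; case: ifP. Qed.

Section Verma.
Variables (C : numFieldType) (k : C) (V : lmodType C) (rho : sl21_rep k V).
Variables (p j : C) (v : V) (hV : is_verma rho p j v).
Local Notation op := (op rho).
Local Notation act := (act rho).
Local Notation filt := (filt rho v).
Local Notation augmentation := (augmentation rho v).

Lemma op_vacuum x : ~~ creation x -> exists c, op x v = c *: v.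
Proof.
case: hV => hw Hp Hm _ _; rewrite /creation.
have [ax _|_ /=] := boolP (annihilator 0 x); first by exists 0; rewrite hw // scale0r.
by rewrite negb_and !negbK => /orP[] /eqP ->; [exists p | exists j].
Qed.

Lemma filt_mono m m' u : (m <= m')%N -> filt m u -> filt m' u.
Proof.
move=> mm'; apply: lspan_sub => _ [w /andP[cw dw] ->]; apply: lspan_gen.
by exists w => //; rewrite cw (leq_trans dw).
Qed.

Lemma filt_creation x m u : creation x -> filt m u -> filt (degree x + m) (op x u).
Proof.
move=> cx; apply: lspan_lin => _ [w /andP[cw dw] ->]; apply: lspan_gen.
by exists (x :: w) => //=; rewrite cx cw wdeg_cons leq_add2l.
Qed.

(** A non-creation [x] moves right until it meets the vacuum, on which it is a scalar;
    [bracket_degree] bounds the bracket terms left behind. *)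
Lemma filt_op_word x w : all creation w -> filt (edegree x + wdeg w) (op x (act w v)).
Proof.
have main y w' : creation y -> all creation w' -> filt (edegree y + wdeg w') (op y (act w' v)).
  move=> cy cw; apply: lspan_gen; exists (y :: w') => //=.
  by rewrite cy cw wdeg_cons /edegree cy /= leqnn.
elim: w x => [|y w IH] x cw.
  have [cx|/op_vacuum[c ->]] := boolP (creation x); first exact: main.
  by apply: lspanZ; apply: lspan_gen; exists [::] => //=; rewrite leq0n.
have [cx|ncx] := boolP (creation x); first exact: main.
have /= /andP[cy cw'] := cw; rewrite opC; apply: lspanD; last apply: lspanD.
- apply: lspanZ; rewrite wdeg_cons addnCA; apply: filt_creation => //; exact: IH.
- apply: lspanZ; apply: lspan_gen; exists w => //; rewrite cw' wdeg_cons; lia.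
apply: lspan_sum => cz Hcz; apply: lspanZ; apply: filt_mono (IH cz.2 cw').
have [d1 d2] := bracket_degree Hcz; rewrite wdeg_cons addnA leq_add2r.
apply: leq_trans (edegree_le _) _; rewrite {1}/edegree ncx /=.
by case: ifP => // /d2.
Qed.

Lemma filt_op x m u : filt m u -> filt (edegree x + m) (op x u).
Proof.
apply: lspan_lin => _ [w /andP[cw dw] ->].
by apply: filt_mono (filt_op_word x cw); rewrite leq_add2l.
Qed.

Lemma filt_act w m u : filt m u -> filt (wdeg w + m) (act w u).
Proof.
move=> Hu; elim: w => //= x w IH; rewrite wdeg_cons -addnA.
by apply: filt_mono (filt_op x IH); rewrite leq_add2r edegree_le.
Qed.

(** The bound contains no contribution of [g]: each bracket of the even [g] with a letter has at
    most the degree of that letter. *)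
Lemma filt_even_comm g w m u : ~~ fermionic g -> filt m u ->
  filt (wdeg w + m) (op g (act w u) - act w (op g u)).
Proof.
move=> eg Hu; elim: w => [|y w IH] /=; first by rewrite subrr; apply: lspan0.
rewrite opC /sgn (negPf eg) /= expr0 scale1r addrAC -linearB /=.
rewrite wdeg_cons -addnA; apply: lspanD; last apply: lspanD.
- by apply: filt_mono (filt_op y IH); rewrite leq_add2r edegree_le.
- by apply: lspanZ; apply: filt_mono (filt_act w Hu); rewrite leq_addl.
apply: lspan_sum => cz Hcz; apply: lspanZ.
have [_ /(_ eg) d2] := bracket_degree Hcz.
apply: filt_mono (filt_op cz.2 (filt_act w Hu)).
by rewrite leq_add2r (leq_trans (edegree_le _)).
Qed.

(** Exactly the generators with [edegree] zero. *)
Definition lowering (x : gen) : bool := ~~ creation x && ~~ fermionic x.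

(** A contraction of [g] with a letter replaces both by a lowering generator, which does not raise
    the filtration, so only the sign of the passage survives in top degree. *)
Lemma filt_odd_comm g w m u : fermionic g -> all fermionic w ->
  (forall y cz, y \in w -> cz \in (bracket k g y).2 -> lowering cz.2) ->
  filt m u ->
  filt (wdeg w + m) (op g (act w u) - (- 1) ^+ size w *: act w (op g u)).
Proof.
move=> og + + Hu; elim: w => [|y w IH] /=.
  by move=> _ _; rewrite expr0 scale1r subrr; apply: lspan0.
move=> /andP[oy ow] Hy; rewrite opC /sgn og oy /= expr1 scaleN1r exprS -scalerA scaleN1r opprK.
rewrite addrAC -linearZ addrC addrC -[_ + op y _]opprK opprD opprK -linearB.
rewrite wdeg_cons -addnA; apply: lspanD; last apply: lspanD.
- apply: lspanN; apply: filt_mono (filt_op y (IH ow _)); first by rewrite leq_add2r edegree_le.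
  by move=> y' cz Hy'; apply: Hy; rewrite in_cons Hy' orbT.
- by apply: lspanZ; apply: filt_mono (filt_act w Hu); rewrite leq_addl.
apply: lspan_sum => cz Hcz; apply: lspanZ.
apply: filt_mono (filt_op cz.2 (filt_act w Hu)).
have := Hy y cz (mem_head _ _) Hcz; rewrite /lowering /edegree => ->.
by rewrite leq_addl.
Qed.

Lemma augmentation_act w u : all creation w -> w != [::] -> augmentation (act w u).
Proof.
move=> cw nw; have [c Hc] := verma_decomp hV u.
rewrite -(subrK (c *: v) u) actD actZ; apply: lspanD; last first.
  by apply: lspanZ; apply: lspan_gen; exists w => //; rewrite cw.
elim: (u - c *: v) / Hc => [|a u1 u2 [w1 /andP[c1 n1] ->] _ IH].
  by rewrite act0; apply: lspan0.
rewrite actD actZ; apply: lspanD => //; apply: lspanZ; apply: lspan_gen.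
exists (w ++ w1); rewrite ?act_cat // all_cat cw c1 /=.
by case: (w) nw.
Qed.

(** Split [u = c *: v + n] with [n] in the augmentation subspace, which [(Hp, 0)] preserves.
    Applying [(Hp, 0)] minus [p + q] to [n] gives [(q * c) *: v], so [c] must vanish because the
    vacuum lies outside that subspace. *)
Lemma augmentation_weight u q : q != 0 -> op (Hp, 0) u = (p + q) *: u -> augmentation u.
Proof.
move=> q0 Hu; have [c Hc] := verma_decomp hV u.
set n := u - c *: v in Hc; have Eu : u = c *: v + n by rewrite addrC subrK.
have Hn : augmentation (op (Hp, 0) n).
  apply: lspan_lin Hc => _ [w Hw ->]; rewrite (act_Hp0 _ (q := p)); last by case: hV.
  by apply: lspanZ; apply: lspan_gen; exists w.
have : augmentation ((q * c) *: v).
  have -> : (q * c) *: v = op (Hp, 0) n - (p + q) *: n.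
    have : op (Hp, 0) u = (c * p) *: v + op (Hp, 0) n.
      by rewrite [in LHS]Eu linearD linearZ /=; case: hV => _ -> _ _ _; rewrite scalerA.
    rewrite Hu Eu scalerDr scalerA => E.
    apply/eqP; rewrite eq_sym subr_eq; apply/eqP.
    apply: (@addrI _ ((c * p) *: v)); rewrite -E addrA -scalerDl; congr (_ *: _ + _).
    by ring.
  by apply: lspanB => //; apply: lspanZ.
have [c00|c0] := eqVneq c 0; first by rewrite Eu c00 scale0r add0r.
move=> /(lspanZ (q * c)^-1); rewrite scalerA mulVf ?mulf_neq0 // scale1r.
by move/(vacuum_notin_augmentation hV).
Qed.

(** * A criterion for a generated submodule to miss the vacuum *)

Section Proper.
Variables (e : V) (Sg : seq gen).
Hypothesis Sg_cover : forall x, ~~ creation x -> x \notin Sg -> exists c, op x e = c *: e.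
Hypothesis Sg_anti : forall x y u, x \in Sg -> y \in Sg -> op x (op y u) = - op y (op x u).
Hypothesis Sg_aug : forall s, uniq s -> {subset s <= Sg} -> augmentation (act s e).

(** A triangular decomposition of the submodule generated by [e], with letters of [Sg] acting first;
    the length bound [l] serves the induction. *)
Definition tri (l : nat) : V -> Prop := lspan (fun u => exists a s,
  [/\ all creation a, {subset s <= Sg}, (size a + size s <= l)%N & u = act (a ++ s) e]).

Lemma tri_mono l l' u : (l <= l')%N -> tri l u -> tri l' u.
Proof.
move=> ll; apply: lspan_sub => _ [a [s [ca ss sz ->]]]; apply: lspan_gen.
by exists a, s; split=> //; apply: leq_trans ll.
Qed.

Lemma tri_creation l x u : creation x -> tri l u -> tri l.+1 (op x u).
Proof.
move=> cx; apply: lspan_lin => _ [a [s [ca ss sz ->]]]; apply: lspan_gen.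
by exists (x :: a), s; split=> //=; rewrite cx.
Qed.

(* The clause without increase is what lets a generator that neither creates nor lies in [Sg] pass
   the first letter of a word in [Sg]. *)
Lemma tri_op l : forall x u, tri l u ->
  tri l.+1 (op x u) /\ (~~ creation x -> x \notin Sg -> tri l (op x u)).
Proof.
elim/ltn_ind: l => l IH.
suff word a s x : all creation a -> {subset s <= Sg} -> (size a + size s <= l)%N ->
    tri l.+1 (op x (act (a ++ s) e)) /\
    (~~ creation x -> x \notin Sg -> tri l (op x (act (a ++ s) e))).
  move=> x1 u Hu; split=> [|ncx nsx]; apply: lspan_lin Hu => _ [a [s [ca ss sz ->]]].
  - by have [] := word a s x1 ca ss sz.
  - by have [_] := word a s x1 ca ss sz; apply.
have tail z y u : (0 < l)%N -> tri l.-1 u ->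
    tri l ((bracket k z y).1 *: u + \sum_(cz <- (bracket k z y).2) cz.1 *: op cz.2 u).
  move=> l0 Hu; apply: lspanD; first by apply: lspanZ; apply: tri_mono Hu; apply: leq_pred.
  apply: lspan_sum => cz _; apply: lspanZ.
  by have [] := IH l.-1 _ cz.2 u Hu; rewrite prednK.
have word_in a' s' : all creation a' -> {subset s' <= Sg} ->
    tri (size a' + size s') (act (a' ++ s') e).
  by move=> ca ss; apply: lspan_gen; exists a', s'.
case: a => [|y a] ca ss sz; last first.
  have /= /andP[cy ca'] := ca; have l0 : (0 < l)%N by apply: leq_trans sz.
  have Ha : tri l.-1 (act (a ++ s) e) by apply: tri_mono (word_in a s ca' ss); move: sz => /=; lia.
  have [H1 H2] := IH l.-1 (ltac:(by rewrite ltn_predL)) x _ Ha; rewrite prednK // in H1.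
  have Ht := tail x y _ l0 Ha.
  rewrite opC; split=> [|ncx nsx]; apply: lspanD => //.
  - by apply: lspanZ; apply: tri_creation.
  - by apply: tri_mono Ht.
  - by apply: lspanZ; have := tri_creation cy (H2 ncx nsx); rewrite prednK.
have [cx|ncx] := boolP (creation x).
  split=> //; apply: tri_creation => //; apply: tri_mono (word_in [::] s _ ss) => //.
have [xS|nxS] := boolP (x \in Sg).
  split=> //; apply: tri_mono (word_in [::] (x :: s) _ _) => //.
  by move=> z; rewrite in_cons => /orP[/eqP -> //|/ss].
suff H : tri l (op x (act ([::] ++ s) e)) by split=> // ; apply: tri_mono H.
case: s ss sz => [|y s] ss sz.
  by have [c ->] := Sg_cover ncx nxS; apply: lspanZ; apply: tri_mono (word_in [::] [::] _ _).
have ss' : {subset s <= Sg} by move=> z zs; apply: ss; rewrite in_cons zs orbT.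
have l0 : (0 < l)%N by apply: leq_trans sz.
have Hs : tri l.-1 (act s e) by apply: tri_mono (word_in [::] s _ ss') => //; move: sz => /=; lia.
have Ht := tail x y _ l0 Hs.
have lt : (l.-1 < l)%N by rewrite ltn_predL.
(* When [x] passes the letter [y] of [Sg], its action on the tail stays at length [l.-1], so that
   applying [y] afterwards reaches at most [l]. *)
have [_ H2] := IH _ lt x _ Hs.
have [H3 _] := IH _ lt y _ (H2 ncx nxS); rewrite prednK // in H3.
by rewrite /= opC; apply: lspanD => //; apply: lspanZ.
Qed.

Lemma act_not_uniq s u : {subset s <= Sg} -> ~~ uniq s -> act s u = 0.
Proof.
have comm x s' u' : x \in Sg -> {subset s' <= Sg} -> x \in s' -> op x (act s' u') = 0.
  move=> xS; elim: s' => // y s' IH ss; rewrite in_cons.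
  have ss' : {subset s' <= Sg} by move=> z zs; apply: ss; rewrite in_cons zs orbT.
  have yS : y \in Sg by apply: ss; rewrite mem_head.
  rewrite /= Sg_anti // => /orP[/eqP E|/(IH ss') ->]; last by rewrite linear0 oppr0.
  have := Sg_anti (act s' u') yS yS; rewrite E => /eqP.
  by rewrite -addr_eq0 -mulr2n -scaler_nat scaler_eq0 pnatr_eq0 /= => /eqP ->; rewrite oppr0.
elim: s => //= x s IH ss; rewrite negb_and negbK.
have ss' : {subset s <= Sg} by move=> z zs; apply: ss; rewrite in_cons zs orbT.
case/orP=> H; last by rewrite IH // linear0.
by apply: comm => //; apply: ss; rewrite mem_head.
Qed.

(** The union of the spaces [tri l] is a submodule containing [e], and it lies in the augmentation
    subspace: words with a creation letter by [augmentation_act], pure words in [Sg] by [Sg_aug] or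
    because a repeated letter gives zero. *)
Lemma proper_generated : ~ generated rho e v.
Proof.
move=> /(_ (fun u => exists l, tri l u)) H; case: (vacuum_notin_augmentation hV).
case: H => [|| l]; last 1 first.
- apply: lspan_sub => _ [a [s [ca ss _ ->]]].
  have [/eqP ->|na] := boolP (a == [::]); last first.
    by rewrite act_cat; apply: augmentation_act.
  have [us|nus] := boolP (uniq s); first exact: Sg_aug.
  by rewrite /= act_not_uniq //; apply: lspan0.
- split.
  + by exists 0%N; apply: lspan0.
  + move=> a u u' [l Hl] [l' Hl']; exists (maxn l l').
    by apply: lspanD; [apply: lspanZ; apply: tri_mono Hl | apply: tri_mono Hl'];
      rewrite leq_max leqnn ?orbT.
  + by move=> x u [l /(tri_op x)[Hl _]]; exists l.+1.
- by exists 0%N; apply: lspan_gen; exists [::], [::].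
Qed.

End Proper.
End Verma.

(** * Odd families and odd reflections *)

Section Families.
Variable b : bool.

(* Indices are shifted so that all four families annihilate the vacuum exactly for i >= 0, and so
   that {dx_i, gy_j} = E12_(i+j) and {dy_i, gx_j} = F12_(i+j+2) for both values of [b]. *)
Definition gx (i : int) : gen := if b then (F2, i + 1) else (F1, i).
Definition gy (i : int) : gen := if b then (E1, i) else (E2, i - 1).
Definition dx (i : int) : gen := if b then (E2, i - 1) else (E1, i).
Definition dy (i : int) : gen := if b then (F1, i) else (F2, i + 1).
Definition eps : int := if b then 1 else -1.

Lemma odd_gx i : fermionic (gx i). Proof. by rewrite /gx; case: b. Qed.
Lemma odd_gy i : fermionic (gy i). Proof. by rewrite /gy; case: b. Qed.
Lemma odd_dx i : fermionic (dx i). Proof. by rewrite /dx; case: b. Qed.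
Lemma odd_dy i : fermionic (dy i). Proof. by rewrite /dy; case: b. Qed.

Lemma creation_gx i : creation (gx i) = (i < 0).
Proof. by rewrite creationE /gx; case: b => /=; lia. Qed.
Lemma creation_gy i : creation (gy i) = (i < 0).
Proof. by rewrite creationE /gy; case: b => /=; lia. Qed.

Lemma creation_dx i : creation (dx i) = (i < 0).
Proof. by rewrite creationE /dx; case: b => /=; lia. Qed.
Lemma creation_dy i : creation (dy i) = (i < 0).
Proof. by rewrite creationE /dy; case: b => /=; lia. Qed.

Lemma odd_gen_cases (x : gen) : fermionic x ->
  exists i, [\/ x = gx i, x = gy i, x = dx i | x = dy i].
Proof.
rewrite /gx /gy /dx /dy; case: x => [[] n] // _; case: b.
- by exists n; apply: Or42.
- by exists n; apply: Or43.
- by exists (n + 1); apply: Or43; rewrite addrK.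
- by exists (n + 1); apply: Or42; rewrite addrK.
- by exists n; apply: Or44.
- by exists n; apply: Or41.
- by exists (n - 1); apply: Or41; rewrite subrK.
- by exists (n - 1); apply: Or44; rewrite subrK.
Qed.

Section Relations.
Variables (C : numFieldType) (k : C) (V : lmodType C) (rho : sl21_rep k V).
Local Notation op := (op rho).

Let zero_ac x y u : sgn C x y = - 1 -> bracket k x y = (0, [::]) ->
  op x (op y u) = - op y (op x u).
Proof. by rewrite opC => -> ->; rewrite big_nil scale0r !addr0 scaleN1r. Qed.

Let ac_swap (u1 u2 u3 : V) : u1 = - u2 + u3 -> u2 = - u1 + u3.
Proof. by move=> ->; rewrite opprD opprK subrK. Qed.

Lemma ac_gx_gx i j u : op (gx i) (op (gx j) u) = - op (gx j) (op (gx i) u).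
Proof. by apply: zero_ac; rewrite /gx; case: b. Qed.
Lemma ac_gy_gy i j u : op (gy i) (op (gy j) u) = - op (gy j) (op (gy i) u).
Proof. by apply: zero_ac; rewrite /gy; case: b. Qed.
Lemma ac_dx_dx i j u : op (dx i) (op (dx j) u) = - op (dx j) (op (dx i) u).
Proof. by apply: zero_ac; rewrite /dx; case: b. Qed.
Lemma ac_dy_dy i j u : op (dy i) (op (dy j) u) = - op (dy j) (op (dy i) u).
Proof. by apply: zero_ac; rewrite /dy; case: b. Qed.
Lemma ac_gx_gy i j u : op (gx i) (op (gy j) u) = - op (gy j) (op (gx i) u).
Proof. by apply: zero_ac; rewrite /gx /gy; case: b. Qed.
Lemma ac_dx_dy i j u : op (dx i) (op (dy j) u) = - op (dy j) (op (dx i) u).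
Proof. by apply: zero_ac; rewrite /dx /dy; case: b. Qed.

Lemma ac_dx_gy i j u : op (dx i) (op (gy j) u)
  = - op (gy j) (op (dx i) u) + op (E12, i + j) u.
Proof.
rewrite opC /dx /gy /sgn /bracket; case: b => /=;
  rewrite big_seq1 /= expr1 scaleN1r ?mulr0 scale0r add0r ?opprK ?mulr1 scale1r;
  by congr (_ + op (E12, _) _); lia.
Qed.

Lemma ac_dy_gx i j u : op (dy i) (op (gx j) u)
  = - op (gx j) (op (dy i) u) + op (F12, i + j + 2) u.
Proof.
rewrite opC /dy /gx /sgn /bracket; case: b => /=;
  rewrite big_seq1 /= expr1 scaleN1r ?mulr0 scale0r add0r ?opprK ?mulr1 scale1r;
  by congr (_ + op (F12, _) _); lia.
Qed.

Let mode_ratr (X : fam) (i : int) : fermionic (X, i) ->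
  ratr (mode (X, i)) = i%:~R + 2^-1 :> C.
Proof.
by rewrite /mode => ->; rewrite rmorphD /= ratr_int fmorph_div /= rmorph1 ratr_nat mul1r.
Qed.

Let mode_sum_odd (x y : gen) : fermionic x -> fermionic y ->
  (mode x + mode y == 0) = (x.2 + y.2 + 1 == 0).
Proof. by move=> fx fy; rewrite mode_sum0 fx ?fy. Qed.

Lemma ac_E1_F1 i j u : op (E1, i) (op (F1, j) u) = - op (F1, j) (op (E1, i) u)
  + ((if i + j + 1 == 0 then - (i%:~R + 2^-1) * k else 0) *: u
     + (op (Hp, i + j + 1) u - op (Hm, i + j + 1) u)).
Proof.
rewrite opC /bracket; lazy beta iota zeta delta [listed_bracket fst snd].
rewrite mode_sum_odd // mode_ratr // big_cons big_seq1 /sgn expr1 !scaleN1r scale1r.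
by congr (_ + (_ *: _ + _)); case: ifP; rewrite ?mulNr ?oppr0.
Qed.

Lemma ac_E2_F2 i j u : op (E2, i) (op (F2, j) u) = - op (F2, j) (op (E2, i) u)
  + ((if i + j + 1 == 0 then (i%:~R + 2^-1) * k else 0) *: u
     + (op (Hp, i + j + 1) u + op (Hm, i + j + 1) u)).
Proof.
rewrite opC /bracket; lazy beta iota zeta delta [listed_bracket fst snd].
by rewrite mode_sum_odd // mode_ratr // big_cons big_seq1 /sgn expr1 !scaleN1r !scale1r.
Qed.

(** The number [eps * i - 1/2] is the mode of [(E2, i - 1)] if [b] holds and minus the mode of
    [(E1, i)] otherwise, which absorbs the opposite signs of the two central terms. *)
Lemma ac_dx_gx i j u : op (dx i) (op (gx j) u) = - op (gx j) (op (dx i) u)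
  + ((if i + j + 1 == 0 then ((eps * i)%:~R - 2^-1) * k else 0) *: u
     + (op (Hp, i + j + 1) u + eps%:~R *: op (Hm, i + j + 1) u)).
Proof.
rewrite /dx /gx /eps; case: b.
  rewrite ac_E2_F2 mul1r scale1r; congr (_ + (_ *: _ + _)); last first.
    by congr (op (_, _) _ + op (_, _) _); lia.
  have -> : i - 1 + (j + 1) + 1 = i + j + 1 by lia.
  by case: ifP => // _; rewrite rmorphB /=; field.
rewrite ac_E1_F1 mulN1r rmorphN scaleN1r; congr (_ + (_ *: _ + _)).
by case: ifP => // _; rewrite ?rmorphN /=; field.
Qed.

Lemma ac_dy_gy i j u : op (dy i) (op (gy j) u) = - op (gy j) (op (dy i) u)
  + ((if i + j + 1 == 0 then ((eps * (i + 1))%:~R - 2^-1) * k else 0) *: u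
     + (op (Hp, i + j + 1) u - eps%:~R *: op (Hm, i + j + 1) u)).
Proof.
rewrite /dy /gy /eps; case: b; apply: ac_swap.
  rewrite ac_E1_F1 mul1r scale1r [j + i]addrC; congr (_ + (_ *: _ + _)).
  case: eqP => // E; have -> : j = - (i + 1) by lia.
  by rewrite rmorphN /=; field.
rewrite ac_E2_F2 mulN1r rmorphN scaleN1r opprK.
have -> : j - 1 + (i + 1) + 1 = i + j + 1 by lia.
congr (_ + (_ *: _ + _)).
case: eqP => // E; have -> : j = - (i + 1) by lia.
by rewrite rmorphB !rmorphN /=; field.
Qed.

(** The bounds on [i + j] here and in the next three lemmas are sharp: below them the bracket
    involves creation generators. They decide which contractions count in top degree. *)
Lemma lowering_dx_gy i j cz : 0 <= i + j ->
  cz \in (bracket k (dx i) (gy j)).2 -> lowering cz.2.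
Proof.
by rewrite /lowering /dx /gy /bracket; case: b => /= H; rewrite inE => /eqP -> /=;
  rewrite creationE /=; lia.
Qed.

Lemma lowering_dx_gx i j cz : -1 <= i + j ->
  cz \in (bracket k (dx i) (gx j)).2 -> lowering cz.2.
Proof.
by rewrite /lowering /dx /gx /bracket; case: b => /= H; rewrite !inE => /orP[] /eqP -> /=;
  rewrite creationE /=; lia.
Qed.

Lemma lowering_dy_gy i j cz : -1 <= i + j ->
  cz \in (bracket k (dy i) (gy j)).2 -> lowering cz.2.
Proof.
by rewrite /lowering /dy /gy /bracket; case: b => /= H; rewrite !inE => /orP[] /eqP -> /=;
  rewrite creationE /=; lia.
Qed.

Lemma lowering_dy_gx i j cz : -1 <= i + j ->
  cz \in (bracket k (dy i) (gx j)).2 -> lowering cz.2.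
Proof.
by rewrite /lowering /dy /gx /bracket; case: b => /= H; rewrite inE => /eqP -> /=;
  rewrite creationE /=; lia.
Qed.

(* [hw t t] is the annihilation condition with theta = [eps * t] (lemma [gen_hw_hw]), and
   [hw (t + 1) t] is the condition halfway between t and t + 1. *)
Definition hw (a c : int) (u : V) : Prop :=
  [/\ forall i : int, - a <= i -> op (gx i) u = 0,
      forall i : int, - c <= i -> op (gy i) u = 0,
      forall i : int, a <= i -> op (dx i) u = 0,
      forall i : int, c <= i -> op (dy i) u = 0
    & forall x, ~~ fermionic x -> annihilator 0 x -> op x u = 0].

Lemma gen_hw_hw (t : int) u : gen_hw rho (eps * t) u <-> hw t t u.
Proof.
split=> [H|[H1 H2 H3 H4 H5] x].
  split=> [i Hi|i Hi|i Hi|i Hi|x ex ax]; apply: H; rewrite ?annihilatorE.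
  1-4: by rewrite /gx /gy /dx /dy /eps; case: b => /=; lia.
  by move: ex ax; rewrite annihilatorE; case: x => [[] n].
have [/odd_gen_cases[i [] ->]|ex] := boolP (fermionic x); last first.
  by move=> ax; apply: H5 => //; move: ex ax; rewrite !annihilatorE; case: x => [[] n].
1-4: rewrite annihilatorE => Hi.
- by apply: H4; move: Hi; rewrite /dy /eps; case: b => /=; lia.
- by apply: H3; move: Hi; rewrite /dx /eps; case: b => /=; lia.
- by apply: H2; move: Hi; rewrite /gy /eps; case: b => /=; lia.
- by apply: H1; move: Hi; rewrite /gx /eps; case: b => /=; lia.
Qed.

Lemma op_kill g x u : op g u = 0 -> (bracket k g x).1 = 0 ->
  (forall cz, cz \in (bracket k g x).2 -> op cz.2 u = 0) -> op g (op x u) = 0.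
Proof.
move=> gu c0 H; rewrite opC gu linear0 scaler0 add0r c0 scale0r add0r.
by rewrite big_seq big1 // => cz Hcz; rewrite H // scaler0.
Qed.

(** This and its three analogues feed [op_kill]: bracketing with an even annihilator lands in the
    same pair of families, at indices where the [hw] conditions already give zero. *)
Let even_bracket_gx g i cz : ~~ fermionic g -> annihilator 0 g ->
  cz \in (bracket k g (gx i)).2 ->
  (exists2 n, i + 1 <= n & cz.2 = gy n) \/ (exists2 n, i + 1 <= n & cz.2 = gx n).
Proof.
rewrite annihilatorE /gx /gy; case: g => [[] n] //= _ Hn; case: b => //=;
  rewrite inE => /eqP -> /=; (try (by left; exists (n + i + 1); [lia | congr (_, _); lia]));
  by right; exists (n + i); [lia | congr (_, _); lia].
Qed.

Let even_bracket_gy g i cz : ~~ fermionic g -> annihilator 0 g ->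
  cz \in (bracket k g (gy i)).2 ->
  (exists2 n, i + 1 <= n & cz.2 = gy n) \/ (exists2 n, i <= n & cz.2 = gx n).
Proof.
rewrite annihilatorE /gx /gy; case: g => [[] n] //= _ Hn; case: b => //=;
  rewrite inE => /eqP -> /=; (try (by left; exists (n + i); [lia | congr (_, _); lia]));
  by right; exists (n + i - 1); [lia | congr (_, _); lia].
Qed.

Let even_bracket_dx g i cz : ~~ fermionic g -> annihilator 0 g ->
  cz \in (bracket k g (dx i)).2 ->
  (exists2 n, i + 1 <= n & cz.2 = dx n) \/ (exists2 n, i <= n & cz.2 = dy n).
Proof.
rewrite annihilatorE /dx /dy; case: g => [[] n] //= _ Hn; case: b => //=;
  rewrite inE => /eqP -> /=; (try (by left; exists (n + i); [lia | congr (_, _); lia]));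
  by right; exists (n + i - 1); [lia | congr (_, _); lia].
Qed.

Let even_bracket_dy g i cz : ~~ fermionic g -> annihilator 0 g ->
  cz \in (bracket k g (dy i)).2 ->
  (exists2 n, i + 1 <= n & cz.2 = dx n) \/ (exists2 n, i + 1 <= n & cz.2 = dy n).
Proof.
rewrite annihilatorE /dx /dy; case: g => [[] n] //= _ Hn; case: b => //=;
  rewrite inE => /eqP -> /=; (try (by left; exists (n + i + 1); [lia | congr (_, _); lia]));
  by right; exists (n + i); [lia | congr (_, _); lia].
Qed.

Let even_odd_const g x : ~~ fermionic g -> fermionic x -> (bracket k g x).1 = 0.
Proof.
by case: g => [[] m] // _; case: x => [[] n] // _; rewrite /bracket /= ?mulr0.
Qed.

(** An odd reflection: [gx (- a - 1)] annihilates its own image because its square is zero, and the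
    price is the conjugate [dx a]. The remaining [dx i] have [i > a], so they meet it without
    central term and only in Cartan modes of positive index. *)
Lemma hw_gx a u : hw a a u -> hw (a + 1) a (op (gx (- a - 1)) u).
Proof.
move=> [H1 H2 H3 H4 H5]; split=> [i Hi|i Hi|i Hi|i Hi|g eg ag].
- have [->|ni] := eqVneq i (- a - 1); first by rewrite op_sq0 // odd_gx.
  by rewrite ac_gx_gx H1 ?linear0 ?oppr0 //; lia.
- by apply/eqP; rewrite -oppr_eq0 -ac_gx_gy H2 // linear0.
- rewrite ac_dx_gx H3; last by lia.
  rewrite ifF; last by lia.
  by rewrite linear0 oppr0 scale0r !H5 ?annihilatorE //= ?scaler0 ?addr0 //; lia.
- by rewrite ac_dy_gx H4 // H5 ?annihilatorE //= ?linear0 ?oppr0 ?addr0 //; lia.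
- apply: op_kill; [exact: H5|by apply: even_odd_const => //; apply: odd_gx|move=> cz].
  by case/(even_bracket_gx eg ag) => -[n Hn ->]; [apply: H2|apply: H1]; lia.
Qed.

Lemma hw_gy a u : hw (a + 1) a u -> hw (a + 1) (a + 1) (op (gy (- a - 1)) u).
Proof.
move=> [H1 H2 H3 H4 H5]; split=> [i Hi|i Hi|i Hi|i Hi|g eg ag].
- by rewrite ac_gx_gy H1 ?linear0 ?oppr0 //; lia.
- have [->|ni] := eqVneq i (- a - 1); first by rewrite op_sq0 // odd_gy.
  by rewrite ac_gy_gy H2 ?linear0 ?oppr0 //; lia.
- by rewrite ac_dx_gy H3 // H5 ?annihilatorE //= ?linear0 ?oppr0 ?addr0 //; lia.
- rewrite ac_dy_gy H4; last by lia.
  rewrite ifF; last by lia.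
  by rewrite linear0 oppr0 scale0r !H5 ?annihilatorE //= ?scaler0 ?subr0 ?addr0 //; lia.
- apply: op_kill; [exact: H5|by apply: even_odd_const => //; apply: odd_gy|move=> cz].
  by case/(even_bracket_gy eg ag) => -[n Hn ->]; [apply: H2|apply: H1]; lia.
Qed.

(** The reflection back: annihilation by [dy a] is gained from its square being zero, and
    annihilation by [gy (- a - 1)] is given up. *)
Lemma hw_dy a u : hw (a + 1) (a + 1) u -> hw (a + 1) a (op (dy a) u).
Proof.
move=> [H1 H2 H3 H4 H5].
split=> [i Hi|i Hi|i Hi|i Hi|g eg ag].
- rewrite (ac_swap (ac_dy_gx _ _ _)) H1; last by lia.
  by rewrite H5 ?annihilatorE //= ?linear0 ?oppr0 ?addr0 //; lia.
- rewrite (ac_swap (ac_dy_gy _ _ _)) H2; last by lia.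
  rewrite ifF; last by lia.
  by rewrite linear0 oppr0 scale0r !H5 ?annihilatorE //= ?scaler0 ?subr0 ?addr0 //; lia.
- by rewrite ac_dx_dy H3 // linear0 oppr0.
- have [->|ni] := eqVneq i a; first by rewrite op_sq0 // odd_dy.
  by rewrite ac_dy_dy H4 ?linear0 ?oppr0 //; lia.
- apply: op_kill; [exact: H5|by apply: even_odd_const => //; apply: odd_dy|move=> cz].
  by case/(even_bracket_dy eg ag) => -[n Hn ->]; [apply: H3|apply: H4]; lia.
Qed.

Lemma hw_dx a u : hw (a + 1) a u -> hw a a (op (dx a) u).
Proof.
move=> [H1 H2 H3 H4 H5].
split=> [i Hi|i Hi|i Hi|i Hi|g eg ag].
- rewrite (ac_swap (ac_dx_gx _ _ _)) H1; last by lia.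
  rewrite ifF; last by lia.
  by rewrite linear0 oppr0 scale0r !H5 ?annihilatorE //= ?scaler0 ?addr0 //; lia.
- rewrite (ac_swap (ac_dx_gy _ _ _)) H2; last by lia.
  by rewrite H5 ?annihilatorE //= ?linear0 ?oppr0 ?addr0 //; lia.
- have [->|ni] := eqVneq i a; first by rewrite op_sq0 // odd_dx.
  by rewrite ac_dx_dx H3 ?linear0 ?oppr0 //; lia.
- by apply/eqP; rewrite -oppr_eq0 -ac_dx_dy H4 // linear0.
- apply: op_kill; [exact: H5|by apply: even_odd_const => //; apply: odd_dx|move=> cz].
  by case/(even_bracket_dx eg ag) => -[n Hn ->]; [apply: H3|apply: H4]; lia.
Qed.

End Relations.
End Families.

(** * The chain of extremal vectors *)

Definition down (g : int -> gen) (n : nat) : seq gen := [seq g (i%:Z - n%:Z) | i <- iota 0 n].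
Definition up (g : int -> gen) (n : nat) : seq gen := [seq g i%:Z | i <- iota 0 n].

Lemma down_S g n : down g n.+1 = g (- n%:Z - 1) :: down g n.
Proof.
rewrite /down /= (iotaDl 1 0 n) -map_comp; congr (g _ :: _); first by lia.
by apply: eq_map => i /=; congr (g _); lia.
Qed.

Lemma up_S g n : up g n.+1 = rcons (up g n) (g n%:Z).
Proof. by rewrite /up -addn1 iotaD map_cat cats1. Qed.

Lemma size_down g n : size (down g n) = n. Proof. by rewrite size_map size_iota. Qed.
Lemma size_up g n : size (up g n) = n. Proof. by rewrite size_map size_iota. Qed.

Lemma mem_downP g n x : x \in down g n -> exists2 i : int, - n%:Z <= i < 0 & x = g i.
Proof.
by case/mapP => i; rewrite mem_iota => Hi ->; exists (i%:Z - n%:Z) => //; lia.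
Qed.

Lemma mem_upP g n x : x \in up g n -> exists2 i : nat, (i < n)%N & x = g i%:Z.
Proof. by case/mapP => i; rewrite mem_iota => Hi ->; exists i. Qed.

Lemma mem_up g (n : nat) (i : int) : 0 <= i < n%:Z -> g i \in up g n.
Proof.
by case: i => // i Hi; apply: map_f; rewrite mem_iota; lia.
Qed.

Lemma wdeg_odd w : all fermionic w -> wdeg w = size w.
Proof. by elim: w => //= x w IH /andP[fx /IH]; rewrite wdeg_cons /degree fx => ->. Qed.

Lemma wdeg_cat w1 w2 : wdeg (w1 ++ w2) = (wdeg w1 + wdeg w2)%N.
Proof. by rewrite /wdeg map_cat sumn_cat. Qed.

Section Chain.
Variable b : bool.
Local Notation gx := (gx b).
Local Notation gy := (gy b).
Local Notation dx := (dx b).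
Local Notation dy := (dy b).
Local Notation eps := (eps b).
Variables (C : numFieldType) (k : C) (V : lmodType C) (rho : sl21_rep k V).
Variables (p j : C) (v : V) (hV : is_verma rho p j v).
Local Notation op := (op rho).
Local Notation act := (act rho).
Local Notation filt := (filt rho v).
Local Notation hw := (hw b rho).

Lemma act_anticomm g w u :
  (forall y u', y \in w -> op g (op y u') = - op y (op g u')) ->
  op g (act w u) = (- 1) ^+ size w *: act w (op g u).
Proof.
elim: w => [|y w IH] H /=; first by rewrite expr0 scale1r.
rewrite H ?mem_head // IH; last by move=> z u' Hz; apply: H; rewrite in_cons Hz orbT.
by rewrite linearZ /= exprS mulN1r scaleNr.
Qed.

Definition word a c : seq gen := down gy a ++ down gx c.
Definition vec a c : V := act (word a c) v.
Definition dual_word a c : seq gen := up dx a ++ up dy c.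

Lemma odd_word a c : all fermionic (word a c).
Proof.
apply/allP => x; rewrite mem_cat => /orP[] /mem_downP[i _ ->].
- exact: odd_gy.
- exact: odd_gx.
Qed.

Lemma odd_dual_word a c : all fermionic (dual_word a c).
Proof.
apply/allP => x; rewrite mem_cat => /orP[] /mem_upP[i _ ->].
- exact: odd_dx.
- exact: odd_dy.
Qed.

Lemma wdeg_word a c : wdeg (word a c) = (a + c)%N.
Proof. by rewrite wdeg_odd ?odd_word // size_cat !size_down. Qed.

Lemma wdeg_dual_word a c : wdeg (dual_word a c) = (a + c)%N.
Proof. by rewrite wdeg_odd ?odd_dual_word // size_cat !size_up. Qed.

Lemma creation_word a c : all creation (word a c).
Proof.
apply/allP => x; rewrite mem_cat => /orP[] /mem_downP[i /andP[_ Hi] ->].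
- by rewrite creation_gy.
- by rewrite creation_gx.
Qed.

Lemma vec_gy a c : vec a.+1 c = op (gy (- a%:Z - 1)) (vec a c).
Proof. by rewrite /vec /word down_S. Qed.

(** The theorem groups the letters by family, while the reflections alternate between [gx] and [gy];
    the sign is the cost of regrouping. *)
Lemma vec_gx a c : vec a c.+1 = (- 1) ^+ a *: op (gx (- c%:Z - 1)) (vec a c).
Proof.
rewrite /vec /word down_S !act_cat /= (act_anticomm (w := down gy a)).
  by rewrite size_down scalerA -exprD addnn -mul2n exprM sqrrN !expr1n scale1r.
by move=> y u' /mem_downP[i _ ->]; rewrite ac_gx_gy.
Qed.

Lemma dual_word_dx a c u :
  act (dual_word a.+1 c) u = (- 1) ^+ c *: act (dual_word a c) (op (dx a%:Z) u).
Proof.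
rewrite /dual_word up_S cat_rcons act_cat /= (act_anticomm (w := up dy c)).
  by rewrite size_up actZ act_cat.
by move=> y u' /mem_upP[i _ ->]; rewrite ac_dx_dy.
Qed.

Lemma dual_word_dy a c u :
  act (dual_word a c.+1) u = act (dual_word a c) (op (dy c%:Z) u).
Proof. by rewrite /dual_word up_S -cats1 catA act_cat. Qed.

Lemma hwZ a c s u : hw a c u -> hw a c (s *: u).
Proof.
by move=> [H1 H2 H3 H4 H5]; split=> *; rewrite linearZ /= ?(H1, H2, H3, H4, H5) ?scaler0.
Qed.

Lemma hw_vacuum : hw 0 0 v.
Proof. by apply/gen_hw_hw; rewrite mulr0; case: hV. Qed.

Lemma hw_vec n : hw n%:Z n%:Z (vec n n) /\ hw (n%:Z + 1) n%:Z (vec n n.+1).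
Proof.
have half m : hw m%:Z m%:Z (vec m m) -> hw (m%:Z + 1) m%:Z (vec m m.+1).
  by move=> H; rewrite vec_gx; apply/hwZ/hw_gx.
elim: n => [|n [_ IH]]; first by have := hw_vacuum; split=> //; apply: half.
suff H : hw n.+1%:Z n.+1%:Z (vec n.+1 n.+1) by split=> //; apply: half.
by rewrite vec_gy (intS n) addrC; apply: hw_gy.
Qed.

Lemma hw_dual_word n u : hw n%:Z n%:Z u -> hw 0 0 (act (dual_word n n) u).
Proof.
elim: n u => [|n IH] u //; rewrite dual_word_dy dual_word_dx (intS n) addrC => H.
by apply/hwZ/IH/hw_dx/hw_dy.
Qed.

Lemma hw_dual_word_half n u : hw (n%:Z + 1) n%:Z u -> hw 0 0 (act (dual_word n.+1 n) u).
Proof. by move=> H; rewrite dual_word_dx; apply/hwZ/hw_dual_word/hw_dx. Qed.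

Lemma Hp_word a c : (\sum_(x <- word a c) hp2 x) = eps * (a + c)%:Z.
Proof.
rewrite (eq_big_seq (fun=> eps)).
  by rewrite big_const_seq count_predT size_cat !size_down iter_addr_0 -mulr_natr natz.
move=> x; rewrite mem_cat => /orP[] /mem_downP[i _ ->].
- by rewrite /gy /eps; case: b.
- by rewrite /gx /eps; case: b.
Qed.

Lemma Hm_word a c : (\sum_(x <- word a c) hm2 x) = a%:Z - c%:Z.
Proof.
rewrite big_cat /=; congr (_ + _).
  rewrite (eq_big_seq (fun=> 1)).
    by rewrite big_const_seq count_predT size_down iter_addr_0 -mulr_natr natz mul1r.
  by move=> x /mem_downP[i _ ->]; rewrite /gy; case: b.
rewrite (eq_big_seq (fun=> -1)).
  by rewrite big_const_seq count_predT size_down iter_addr_0 -mulr_natr natz mulN1r.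
by move=> x /mem_downP[i _ ->]; rewrite /gx; case: b.
Qed.

Lemma Hp_vec a c : op (Hp, 0) (vec a c) = (p + (eps * (a + c)%:Z)%:~R / 2) *: vec a c.
Proof. by rewrite -Hp_word; apply: act_Hp0; case: hV. Qed.

Lemma Hm_vec a c : op (Hm, 0) (vec a c) = (j + (a%:Z - c%:Z)%:~R / 2) *: vec a c.
Proof. by rewrite -Hm_word; apply: act_Hm0; case: hV. Qed.

(** The anticommutator of [dx n] with the last applied mode [gx (- n - 1)] acts on [vec n n] by the
    scalar [(eps * n - 1/2) * k + p + eps * n + eps * j], which the charged condition makes zero. *)
Lemma hw_crit_dx n : p + eps%:~R * j - k / 2 = - (eps * n%:Z)%:~R * (k + 1) ->
  hw n%:Z n%:Z (vec n n.+1).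
Proof.
move=> crit; have [Hu Hw] := hw_vec n; case: (Hw) => H1 H2 H3 H4 H5.
case: Hu => K1 K2 K3 K4 K5.
split=> // [i Hi|i Hi]; first by apply: H1; lia.
have [->|ni] := eqVneq i n%:Z; last by apply: H3; lia.
rewrite vec_gx linearZ /= ac_dx_gx K3 // linear0 oppr0 add0r.
have -> : n%:Z + (- n%:Z - 1) + 1 = 0 :> int by lia.
rewrite eqxx Hp_vec Hm_vec subrr scalerA -!scalerDl.
suff -> : ((eps * n%:Z)%:~R - 2^-1) * k + (p + (eps * (n + n)%N%:Z)%:~R / 2 +
  eps%:~R * (j + (0 : int)%:~R / 2)) = 0 :> C by rewrite scale0r scaler0.
have -> : (eps * (n + n)%N%:Z)%:~R = 2 * (eps * n%:Z)%:~R :> C.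
  by rewrite PoszD mulrDr rmorphD /=; ring.
have -> : p = - (eps * n%:Z)%:~R * (k + 1) - eps%:~R * j + k / 2 by rewrite -crit; ring.
by rewrite mulr0z; field.
Qed.

(** The same mechanism on [vec n n.+1], where the [(Hm, 0)] eigenvalue is [j - 1/2]; the scalar is
    [(eps * (n + 1) - 1/2) * k + p - eps * j + eps * (n + 1)]. *)
Lemma hw_crit_dy n : p - eps%:~R * j - k / 2 = - (eps * n.+1%:Z)%:~R * (k + 1) ->
  hw n.+1%:Z n%:Z (vec n.+1 n.+1).
Proof.
move=> crit; have [Hu _] := hw_vec n.+1; case: (Hu) => H1 H2 H3 H4 H5.
have [_ [K1 K2 K3 K4 K5]] := hw_vec n.
split=> // [i Hi|i Hi]; first by apply: H2; lia.
have [->|ni] := eqVneq i n%:Z; last by apply: H4; lia.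
rewrite vec_gy ac_dy_gy K4 // linear0 oppr0 add0r.
have -> : n%:Z + (- n%:Z - 1) + 1 = 0 :> int by lia.
rewrite eqxx Hp_vec Hm_vec scalerA -scaleNr -!scalerDl.
have -> : n%:Z - n.+1%:Z = -1 :> int by lia.
have -> : n%:Z + 1 = n.+1%:Z :> int by lia.
have -> : (eps * (n + n.+1)%N%:Z)%:~R = 2 * (eps * n.+1%:Z)%:~R - eps%:~R :> C.
  have -> : (n + n.+1)%N%:Z = 2 * n.+1%:Z - 1 :> int by lia.
  by rewrite mulrBr mulr1 rmorphB /= mulrCA rmorphM.
have -> : p = - (eps * n.+1%:Z)%:~R * (k + 1) + eps%:~R * j + k / 2 by rewrite -crit; ring.
rewrite mulrN1z -[X in X *: _](_ : 0 = _) ?scale0r //.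
by field.
Qed.

End Chain.

(** * Leading term of S *)

Section Approx.
Variables (C : numFieldType) (k : C) (V : lmodType C) (rho : sl21_rep k V).
Variables (p j : C) (v : V) (hV : is_verma rho p j v).
Local Notation op := (op rho).
Local Notation act := (act rho).
Local Notation filt := (filt rho v).

(* Equality up to sign, modulo lower degree. *)
Definition approx (m : nat) (u u' : V) : Prop :=
  exists s : nat, filt m (u - (- 1) ^+ s *: u').

Lemma approx_filt m u u' : filt m (u - u') -> approx m u u'.
Proof. by exists 0%N; rewrite expr0 scale1r. Qed.

Lemma approx_sign m s u : approx m ((- 1) ^+ s *: u) u.
Proof. by exists s; rewrite subrr; apply: lspan0. Qed.

Lemma approx_trans m u u' u'' : approx m u u' -> approx m u' u'' -> approx m u u''.
Proof.
move=> [s Hs] [t Ht]; exists (s + t)%N.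
have -> : u - (- 1) ^+ (s + t) *: u'' =
    (u - (- 1) ^+ s *: u') + (- 1) ^+ s *: (u' - (- 1) ^+ t *: u'').
  by rewrite scalerBr scalerA -exprD addrA subrK.
by apply: lspanD => //; apply: lspanZ.
Qed.

Lemma approx_mono m m' u u' : (m <= m')%N -> approx m u u' -> approx m' u u'.
Proof. by move=> mm [s Hs]; exists s; apply: filt_mono Hs. Qed.

Lemma approx_act w m u u' : approx m u u' -> approx (wdeg w + m) (act w u) (act w u').
Proof.
move=> [s Hs]; exists s; have := filt_act hV w Hs.
by rewrite actD -[- (_ *: u')]scaleN1r !actZ scaleN1r.
Qed.

Lemma approx_op x m u u' : approx m u u' -> approx (degree x + m) (op x u) (op x u').
Proof. by move/(approx_act [:: x]); rewrite wdeg_cons addn0. Qed.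

Lemma approx_neq0 m u w : pbw_monomial w -> (m < wdeg w)%N ->
  approx m u (act w v) -> u <> 0.
Proof.
move=> pw mw [s + u0]; rewrite u0 sub0r => /lspanN; rewrite opprK.
move/(lspanZ ((- 1) ^+ s)); rewrite scalerA -exprD addnn -mul2n exprM sqrrN !expr1n scale1r.
exact: (pbw_notin_filt hV).
Qed.

End Approx.

Section Leading.
Variable b : bool.
Local Notation gx := (gx b).
Local Notation gy := (gy b).
Local Notation dx := (dx b).
Local Notation dy := (dy b).
Local Notation eps := (eps b).
Variables (C : numFieldType) (k : C) (V : lmodType C) (rho : sl21_rep k V).
Variables (p j : C) (v : V) (hV : is_verma rho p j v).
Local Notation op := (op rho).
Local Notation act := (act rho).
Local Notation filt := (filt rho v).
Local Notation hw := (hw b rho).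
Local Notation word := (word b).
Local Notation vec := (vec b rho v).
Local Notation dual_word := (dual_word b).
Local Notation approx := (approx rho v).

(** One [(E12, -1)] for each surviving contraction of [dx] with [gy], one [(F12, 0)] for each of
    [dy] with [gx], and the letter [gx (-1)] left unpaired, written in PBW order. *)
Definition leading a c : seq gen := nseq a (E12, -1) ++ nseq c (F12, 0) ++ [:: gx (-1)].

Lemma wdeg_leading a c : wdeg (leading a c) = (2 * a + 2 * c + 1)%N.
Proof.
rewrite /leading !wdeg_cat addnA /wdeg /= addn0 !map_nseq !sumn_nseq /degree /= odd_gx; lia.
Qed.

Lemma pbw_leading a c : pbw_monomial (leading a c).
Proof.
rewrite /pbw_monomial /leading !all_cat !all_nseq /= creation_gx !creationE /= !orbT /=.
have H m : path ordered_step (F12, 0) (nseq m (F12, 0) ++ [:: gx (-1)]).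
  by elim: m => [|m IH] /=; rewrite ?IH /gx; case: b.
have H' m : path ordered_step (E12, -1) (nseq m (E12, -1) ++ nseq c (F12, 0) ++ [:: gx (-1)]).
  elim: m => [|m IH] /=; last by rewrite IH.
  by case: c => [|c'] /=; rewrite ?H /gx; case: b.
by case: a => [|a] /=; [case: c {H'} => [|c'] /=; rewrite ?H |exact: H'].
Qed.

Lemma filt_vec a c : filt (a + c) (vec a c).
Proof.
by apply: lspan_gen; exists (word a c); rewrite ?creation_word ?wdeg_word ?leqnn.
Qed.

Lemma filt_vacuum : filt 0 v.
Proof. by apply: lspan_gen; exists [::]. Qed.

Lemma filt_dual_vec g a c : fermionic g -> op g v = 0 ->
  (forall y cz, y \in word a c -> cz \in (bracket k g y).2 -> lowering cz.2) ->
  filt (a + c) (op g (vec a c)).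
Proof.
move=> fg gv H; have := filt_odd_comm hV fg (odd_word b a c) H filt_vacuum.
by rewrite gv act0 scaler0 subr0 wdeg_word addn0.
Qed.

(** Among the letters of the word only [gy (- n - 1)] contracts with [dx n] to a creation generator;
    all other contractions are lowering. In [dy_vec] the exceptional letter is [gx (- n - 2)]. *)
Lemma dx_vec n : approx (2 * n + 2) (op (dx n%:Z) (vec n.+1 n.+1)) (op (E12, -1) (vec n n.+1)).
Proof.
apply: approx_filt; rewrite vec_gy ac_dx_gy.
have -> : n%:Z + (- n%:Z - 1) = -1 :> int by lia.
rewrite addrK; apply: lspanN.
have -> : (2 * n + 2 = 1 + (n + n.+1))%N by lia.
apply: filt_mono (filt_op hV _ (filt_dual_vec _ _ _)).
- by rewrite leq_add2r (leq_trans (edegree_le _)) // /degree odd_gy.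
- exact: odd_dx.
- by case: (hw_vacuum b hV) => _ _ H _ _; apply: H.
move=> y cz; rewrite mem_cat => /orP[] /mem_downP[i Hi ->].
- by apply: lowering_dx_gy; lia.
- by apply: lowering_dx_gx; lia.
Qed.

Lemma dy_vec n : approx (2 * n + 3) (op (dy n%:Z) (vec n.+1 n.+2)) (op (F12, 0) (vec n.+1 n.+1)).
Proof.
rewrite vec_gx linearZ; apply: approx_trans (approx_sign _ _ _ _ _) _.
apply: approx_filt; rewrite ac_dy_gx.
have -> : n%:Z + (- n.+1%:Z - 1) + 2 = 0 :> int by lia.
rewrite addrK; apply: lspanN.
have -> : (2 * n + 3 = 1 + (n.+1 + n.+1))%N by lia.
apply: filt_mono (filt_op hV _ (filt_dual_vec _ _ _)).
- by rewrite leq_add2r (leq_trans (edegree_le _)) // /degree odd_gx.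
- exact: odd_dy.
- by case: (hw_vacuum b hV) => _ _ _ H _; apply: H.
move=> y cz; rewrite mem_cat => /orP[] /mem_downP[i Hi ->].
- by apply: lowering_dy_gy; lia.
- by apply: lowering_dy_gx; lia.
Qed.

(** The [(E12, -1)] released by [dx_vec] moves to the far left modulo lower degree, leaving the
    previous stage of the induction to its right. *)
Lemma leading_half n :
  approx (4 * n) (act (dual_word n n) (vec n n.+1)) (act (leading n n) v) ->
  approx (4 * n + 2) (act (dual_word n.+1 n) (vec n.+1 n.+1)) (act (leading n.+1 n) v).
Proof.
move=> IH; rewrite dual_word_dx; apply: approx_trans (approx_sign _ _ _ _ _) _.
apply: approx_trans.
  apply: approx_mono (approx_act hV (dual_word n n) (dx_vec n)).
  by rewrite wdeg_dual_word; lia.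
apply: approx_trans.
  apply: approx_filt; rewrite -opprB; apply: lspanN.
  apply: filt_mono (filt_even_comm hV (dual_word n n) _ (filt_vec n n.+1)) => //.
  by rewrite wdeg_dual_word; lia.
apply: approx_mono (approx_op hV (E12, -1) IH).
by rewrite /degree /=; lia.
Qed.

Lemma leading_full n :
  approx (4 * n) (act (dual_word n n) (vec n n.+1)) (act (leading n n) v).
Proof.
elim: n => [|n /leading_half IH].
  by apply: approx_filt; rewrite /leading /vec /word /= subrr; apply: lspan0.
rewrite dual_word_dy; apply: approx_trans.
  apply: approx_mono (approx_act hV (dual_word n.+1 n) (dy_vec n)).
  by rewrite wdeg_dual_word; lia.
apply: approx_trans.
  apply: approx_filt; rewrite -opprB; apply: lspanN.
  apply: filt_mono (filt_even_comm hV (dual_word n.+1 n) _ (filt_vec n.+1 n.+1)) => //.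
  by rewrite wdeg_dual_word; lia.
apply: approx_trans.
  by apply: approx_mono (approx_op hV (F12, 0) IH); rewrite /degree /=; lia.
(* The new [(F12, 0)] stands in front of the powers of [(E12, -1)], but PBW order puts it behind
   them; the swap is again free modulo lower degree. *)
apply: approx_filt; rewrite /leading !act_cat /=.
rewrite -[op (F12, 0) (act (nseq n _) _)]/(act (nseq n.+1 (F12, 0)) _).
have H : filt (2 * n + 1) (act (nseq n (F12, 0) ++ [:: gx (-1)]) v).
  apply: lspan_gen; exists (nseq n (F12, 0) ++ [:: gx (-1)]) => //.
  have /andP[cl _] := pbw_leading 0 n; have := wdeg_leading 0 n.
  by rewrite /leading /= in cl * => ->; rewrite cl; lia.
rewrite -/(act (_ :: _) _).
have := filt_even_comm hV (nseq n.+1 (E12, -1)) (g := (F12, 0)) isT H.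
rewrite act_cat; apply: filt_mono.
by rewrite /wdeg map_nseq sumn_nseq /degree /=; lia.
Qed.

End Leading.

(** * The charged singular vectors *)

Section Singular.
Variable b : bool.
Local Notation gx := (gx b).
Local Notation gy := (gy b).
Local Notation dx := (dx b).
Local Notation dy := (dy b).
Local Notation eps := (eps b).
Variables (C : numFieldType) (k : C) (V : lmodType C) (rho : sl21_rep k V).
Variables (p j : C) (v : V) (hV : is_verma rho p j v).
Local Notation op := (op rho).
Local Notation act := (act rho).
Local Notation hw := (hw b rho).
Local Notation word := (word b).
Local Notation vec := (vec b rho v).
Local Notation dual_word := (dual_word b).

Lemma hp2_dual x a c : x \in dual_word a c -> hp2 x = - eps.
Proof.
rewrite mem_cat => /orP[] /mem_upP[i _ ->].
- by rewrite /dx /eps; case: b.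
- by rewrite /dy /eps; case: b.
Qed.

Lemma vec_proper a c : hw a%:Z c%:Z (vec a c.+1) -> ~ generated rho (vec a c.+1) v.
Proof.
move=> [H1 H2 H3 H4 H5]; apply: (proper_generated hV (Sg := dual_word a c)).
- move=> x ncx; rewrite mem_cat negb_or => /andP[nx ny].
  have [fx|ex] := boolP (fermionic x).
    exists 0; rewrite scale0r; have [i [Ex|Ex|Ex|Ex]] := odd_gen_cases b fx;
      move: ncx nx ny; rewrite {}Ex ?(creation_gx, creation_gy, creation_dx, creation_dy) -leNgt;
      move=> i0 nx ny.
    + by apply: H1; lia.
    + by apply: H2; lia.
    + by apply: H3; rewrite leNgt; apply: contra nx => ia; apply: mem_up; rewrite i0.
    + by apply: H4; rewrite leNgt; apply: contra ny => ia; apply: mem_up; rewrite i0.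
  move: ncx; rewrite /creation; have [ax _|_ /=] := boolP (annihilator 0 x).
    by exists 0; rewrite H5 // scale0r.
  rewrite negb_and !negbK => /orP[] /eqP ->.
  + by exists (p + (eps * (a + c.+1)%:Z)%:~R / 2); exact: (Hp_vec b hV).
  + by exists (j + (a%:Z - c.+1%:Z)%:~R / 2); exact: (Hm_vec b hV).
- move=> x y u; rewrite !mem_cat.
  move=> /orP[] /mem_upP[i _ ->] /orP[] /mem_upP[i' _ ->].
  + exact: ac_dx_dx.
  + exact: ac_dx_dy.
  + by rewrite ac_dx_dy opprK.
  + exact: ac_dy_dy.
move=> s us ss; have sz : (size s <= a + c)%N.
  by have := uniq_leq_size us ss; rewrite size_cat !size_up.
have Es : \sum_(x <- s) hp2 x = - eps * (size s)%:Z.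
  rewrite (eq_big_seq (fun=> - eps)); last by move=> x /ss /hp2_dual.
  by rewrite big_const_seq count_predT iter_addr_0 -mulr_natr natz.
(* The truncated subtraction is exact and positive: [s] has at most [a + c] letters, one fewer than
   the word of [vec a c.+1], so the charge does not return to that of the vacuum. *)
apply: (augmentation_weight hV (q := (eps * (a + c.+1 - size s)%N%:Z)%:~R / 2)).
  rewrite mulf_neq0 ?invr_eq0 ?pnatr_eq0 // intr_eq0 /eps.
  by case: b; lia.
rewrite (act_Hp0 _ (Hp_vec b hV a c.+1)) Es; congr (_ *: _).
rewrite -addrA -mulrDl -rmorphD /= mulNr -mulrBr; congr (_ + (_ * _)%:~R / _).
by rewrite subzn // addnS; apply: leqW.
Qed.

(** Nonvanishing is checked on [S], whose leading term is known, and passes to the topological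
    vector by linearity. Properness goes the other way, since [S] lies in the submodule generated by
    that vector. *)
Lemma vec_singular a c : a = c \/ a = c.+1 ->
  gen_hw rho (eps * a%:Z) (vec a c.+1) -> hw a%:Z c%:Z (vec a c.+1) ->
  let S := act (dual_word a c) (vec a c.+1) in
  [/\ singular rho (vec a c.+1), representative rho (vec a c.+1) 0 S & singular rho S].
Proof.
move=> ac gE hE S; have nE := vec_proper hE.
have S0 : S <> 0.
  case: ac hE @S {nE gE} => -> hE /=.
    by apply: (approx_neq0 hV (pbw_leading b c c) _ (leading_full b hV c));
      rewrite wdeg_leading; lia.
  by apply: (approx_neq0 hV (pbw_leading b c.+1 c) _
    (leading_half hV (leading_full b hV c))); rewrite wdeg_leading; lia.
have E0 : vec a c.+1 <> 0 by move=> E0; apply: S0; rewrite /S E0 act0.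
have hS : gen_hw rho 0 S.
  rewrite -(mulr0 eps); apply/gen_hw_hw.
  case: ac hE @S {nE gE S0 E0} => -> hE /=; first exact: hw_dual_word.
  by apply: hw_dual_word_half; move: hE; rewrite intS addrC.
have gS : generated rho (vec a c.+1) S.
  move=> P [_ _ PO] PE; rewrite /S; elim: (dual_word a c) => //= x w IH.
  exact: PO.
split.
- by split=> //; [exists (eps * a%:Z) | exists v].
- by split=> //; exists (dual_word a c); split=> //; apply: odd_dual_word.
- split=> //; first by exists 0.
  exists v => GS; apply: nE => P PP PE; apply: GS => //; exact: gS.
Qed.

End Singular.

(** * Topological conditions from one extra annihilation *)

Section Topological.
Variables (C : numFieldType) (k : C) (V : lmodType C) (rho : sl21_rep k V).
Local Notation op := (op rho).

(** The Cartan condition is the anticommutator of the two annihilating modes [(E2, r - 1)] and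
    [(F2, - r)]. For [topological1P] the modes are [(E1, - r)] and [(F1, r - 1)]. *)
Lemma topological2P (r : int) e :
  gen_hw rho r e -> op (F2, - r) e = 0 -> topological2 rho r e.
Proof.
move=> he F0; split=> // [[X m] /= ->|].
  rewrite /mode /= => H; have -> : m = - r; last exact: F0.
  by apply: (@intr_inj rat); rewrite rmorphN /=; lra.
have E0 : op (E2, r - 1) e = 0 by apply: he; rewrite annihilatorE /= lexx.
have := ac_E2_F2 rho (r - 1) (- r) e.
have -> : r - 1 + - r + 1 = 0 :> int by lia.
rewrite eqxx F0 E0 !linear0 add0r => E.
rewrite -addrA [op (Hm, 0) e + _]addrC E; congr (_ * _ *: _ + _).
by rewrite rmorphB /=; field.
Qed.

Lemma topological1P (r : int) e :
  gen_hw rho r e -> op (F1, r - 1) e = 0 -> topological1 rho r e.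
Proof.
move=> he F0; split=> // [[X m] /= ->|].
  rewrite /mode /= => H; have -> : m = r - 1; last exact: F0.
  by apply: (@intr_inj rat); rewrite rmorphB /=; lra.
have E0 : op (E1, - r) e = 0 by apply: he; rewrite annihilatorE /= lexx.
have := ac_E1_F1 rho (- r) (r - 1) e.
have -> : - r + (r - 1) + 1 = 0 :> int by lia.
rewrite eqxx F0 E0 !linear0 add0r => E.
rewrite -addrA [- op (Hm, 0) e + _]addrC E; congr (_ * _ *: _ + _).
by rewrite rmorphN /=; field.
Qed.

End Topological.

(** * The products of the theorem as words in the four families *)

Lemma run_iota X (i : int) (n : nat) (a e : rat) :
  a = i%:~R + 1 / 2 -> e = a + n%:R - 1 ->
  run X a e = [seq (X, i + m%:Z) | m <- iota 0 n].
Proof.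
move=> Ea Ee; rewrite /run.
have -> : Num.floor a = i.
  by apply: floor_def; rewrite Ea rmorphD /=; lra.
have -> : e - a + 1 = n%:R by rewrite Ee; ring.
have -> : Num.truncn (n%:R : rat) = n.
  by apply: truncn_def; rewrite lexx ltr_nat ltnSn.
by [].
Qed.

Ltac solve_runs :=
  rewrite ?rmorphD ?rmorphN ?rmorphB /= -?pmulrn -?natr1; by field.

(** In case (II), [b = true] gives words of shape [n, n.+1] and [b = false] gives [n.+1, n.+1]; in
    case (I) the two shapes are exchanged. *)
Lemma E2ch_nat (n : nat) : E2ch n%:Z = word true n n.+1.
Proof.
rewrite /E2ch; have -> : (n%:Z <= -1) = false by lia.
rewrite /word /down /gx /gy.
rewrite (@run_iota E1 (- n%:Z) n) ?(@run_iota F2 (- n%:Z) n.+1) //; try solve_runs.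
by congr (_ ++ _); apply: eq_map => i; congr (_, _); lia.
Qed.

Lemma S2ch_nat (n : nat) : S2ch n%:Z = dual_word true n n.
Proof.
rewrite /S2ch; have -> : (n%:Z <= -1) = false by lia.
rewrite /dual_word /up /dx /dy.
rewrite (@run_iota E2 (- 1) n) ?(@run_iota F1 0 n) //; solve_runs.
Qed.

Lemma E2ch_neg (n : nat) : E2ch (- n.+1%:Z) = word false n.+1 n.+1.
Proof.
rewrite /E2ch; have -> : (- n.+1%:Z <= -1) = true by lia.
rewrite /word /down /gx /gy.
rewrite (@run_iota E2 (- n.+1%:Z - 1) n.+1) ?(@run_iota F1 (- n.+1%:Z) n.+1) //; try solve_runs.
by congr (_ ++ _); apply: eq_map => i; congr (_, _); lia.
Qed.

Lemma S2ch_neg (n : nat) : S2ch (- n.+1%:Z) = dual_word false n.+1 n.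
Proof.
rewrite /S2ch; have -> : (- n.+1%:Z <= -1) = true by lia.
rewrite /dual_word /up /dx /dy.
rewrite (@run_iota E1 0 n.+1) ?(@run_iota F2 1 n) //; try solve_runs.
by congr (_ ++ _); apply: eq_map => i; congr (_, _); lia.
Qed.

Lemma E1ch_neg (n : nat) : E1ch (- n%:Z) = word false n n.+1.
Proof.
rewrite /E1ch; have -> : (- n%:Z <= 0) = true by lia.
rewrite /word /down /gx /gy.
rewrite (@run_iota E2 (- n%:Z - 1) n) ?(@run_iota F1 (- n.+1%:Z) n.+1) //; try solve_runs.
by congr (_ ++ _); apply: eq_map => i; congr (_, _); lia.
Qed.

Lemma S1ch_neg (n : nat) : S1ch (- n%:Z) = dual_word false n n.
Proof.
rewrite /S1ch; have -> : (- n%:Z <= 0) = true by lia.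
rewrite /dual_word /up /dx /dy.
rewrite (@run_iota E1 0 n) ?(@run_iota F2 1 n) //; try solve_runs.
by congr (_ ++ _); apply: eq_map => i; congr (_, _); lia.
Qed.

Lemma E1ch_pos (n : nat) : E1ch n.+1%:Z = word true n.+1 n.+1.
Proof.
rewrite /E1ch; have -> : (n.+1%:Z <= 0) = false by lia.
rewrite /word /down /gx /gy.
rewrite (@run_iota E1 (- n.+1%:Z) n.+1) ?(@run_iota F2 (- n%:Z) n.+1) //; try solve_runs.
by congr (_ ++ _); apply: eq_map => i; congr (_, _); lia.
Qed.

Lemma S1ch_pos (n : nat) : S1ch n.+1%:Z = dual_word true n.+1 n.
Proof.
rewrite /S1ch; have -> : (n.+1%:Z <= 0) = false by lia.
rewrite /dual_word /up /dx /dy.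
rewrite (@run_iota E2 (- 1) n.+1) ?(@run_iota F1 0 n) //; solve_runs.
Qed.

(** * The two charged cases and the theorem *)

Section Cases.
Variables (C : numFieldType) (k : C) (V : lmodType C) (rho : sl21_rep k V).
Variables (p j : C) (v : V) (hV : is_verma rho p j v).
Local Notation op := (op rho).
Local Notation act := (act rho).

Let dir (b : bool) : C := (eps b)%:~R.

(** The charged condition supplies the annihilation by [dx n] that the parameter [eps b * n]
    demands. The topological mode [gx b (- n - 1)] annihilates because it is already a factor of
    [E], with square zero. *)
Lemma charged_full b n : p + dir b * j - k / 2 = - (eps b * n%:Z)%:~R * (k + 1) ->
  let E := act (word b n n.+1) v in let S := act (dual_word b n n) E in
  [/\ gen_hw rho (eps b * n%:Z) E, op (gx b (- n%:Z - 1)) E = 0,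
      singular rho E, representative rho E 0 S & singular rho S].
Proof.
move=> crit E S; have hE := hw_crit_dx hV crit.
have gE : gen_hw rho (eps b * n%:Z) E by apply/gen_hw_hw.
have [sE rS sS] := vec_singular hV (or_introl (erefl n)) gE hE.
split=> //; have [_ [H _ _ _ _]] := hw_vec b hV n; apply: H; lia.
Qed.

(** Here the reflections alone give the highest-weight conditions, and the charged condition
    supplies the topological annihilation by [dy b n]. *)
Lemma charged_half b n : p - dir b * j - k / 2 = - (eps b * n.+1%:Z)%:~R * (k + 1) ->
  let E := act (word b n.+1 n.+1) v in let S := act (dual_word b n.+1 n) E in
  [/\ gen_hw rho (eps b * n.+1%:Z) E, op (dy b n%:Z) E = 0,
      singular rho E, representative rho E 0 S & singular rho S].
Proof.
move=> crit E S; have hE := hw_crit_dy hV crit.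
have gE : gen_hw rho (eps b * n.+1%:Z) E by apply/gen_hw_hw; case: (hw_vec b hV n.+1).
have [sE rS sS] := vec_singular hV (or_intror (erefl n.+1)) gE hE.
by split=> //; case: hE => _ _ _ H _; apply: H.
Qed.

Lemma charged2 (r : int) : p + j - k / 2 = - r%:~R * (k + 1) ->
  let E := act (E2ch r) v in let S := act (S2ch r) E in
  [/\ singular rho E, topological2 rho r E, representative rho E 0 S & singular rho S].
Proof.
case: r => n crit E S.
  have [|gE F0 sE rS sS] := @charged_full true n; first by rewrite /dir /eps mulr1z !mul1r.
  rewrite /S /E S2ch_nat E2ch_nat; split=> //; apply: topological2P.
    by move: gE; rewrite mul1r.
  by move: F0; rewrite /gx subrK.
have [|gE F0 sE rS sS] := @charged_half false n.
  by rewrite /dir /eps mulrN1z !mulN1r opprK -NegzE.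
rewrite /S /E NegzE S2ch_neg E2ch_neg; split=> //; apply: topological2P.
  by move: gE; rewrite mulN1r.
by move: F0; rewrite /dy opprK intS addrC.
Qed.

Lemma charged1 (r : int) : p - j - k / 2 = - r%:~R * (k + 1) ->
  let E := act (E1ch r) v in let S := act (S1ch r) E in
  [/\ singular rho E, topological1 rho r E, representative rho E 0 S & singular rho S].
Proof.
(* Unlike in case (II), [r = 0] goes with the negative values, as in the definition of [E1ch]. *)
have [[n ->]|[n ->]] : (exists n : nat, r = - n%:Z) \/ (exists n : nat, r = n.+1%:Z).
  by case: r => [[|n]|n]; [left; exists 0%N | right; exists n | left; exists n.+1; rewrite NegzE].
- move=> crit E S; have [|gE F0 sE rS sS] := @charged_full false n.
    by rewrite /dir /eps mulrN1z !mulN1r.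
  rewrite /S /E S1ch_neg E1ch_neg; split=> //; apply: topological1P => //.
  by move: gE; rewrite mulN1r.
move=> crit E S; have [|gE F0 sE rS sS] := @charged_half true n.
  by rewrite /dir /eps mulr1z !mul1r.
rewrite /S /E S1ch_pos E1ch_pos; split=> //; apply: topological1P.
  by move: gE; rewrite mul1r.
by have -> : n.+1%:Z - 1 = n%:Z by lia.
Qed.

End Cases.

Theorem theorem3p3 (R : realType) (p j k : R[i]) (r : int)
    (V : lmodType R[i]) (rho : sl21_rep k V) (v : V) (hV : is_verma rho p j v)
    (hr : p + j - k / 2 = - r%:~R * (k + 1) \/
          p - j - k / 2 = - r%:~R * (k + 1)) :
  (exists e : V, singular rho e) /\
  (p + j - k / 2 = - r%:~R * (k + 1) ->
     let E := act rho (E2ch r) v in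
     let S := act rho (S2ch r) E in
     [/\ singular rho E, topological2 rho r E,
         representative rho E 0 S & singular rho S]) /\
  (p - j - k / 2 = - r%:~R * (k + 1) ->
     let E := act rho (E1ch r) v in
     let S := act rho (S1ch r) E in
     [/\ singular rho E, topological1 rho r E,
         representative rho E 0 S & singular rho S]).
Proof.
split; last by split; [exact: (charged2 hV) | exact: (charged1 hV)].
by case: hr => [/(charged2 hV)|/(charged1 hV)] [sE _ _ _]; eexists; exact: sE.
Qed.
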